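(* Let $R$ be a commutative ring with $1$, let $n\ge1$, and let $(\mathcal C,\mathbb E,\mathfrak s)$ be a small $R$-linear extriangulated category. (1) If $\mathcal X=\operatorname{add}\mathcal X$ is a strongly covariantly finite and $n$-rigid subcategory, then $$\mathcal X=\bigcap_{i=1}^{n}{}^{\perp_i}\mathcal X\quad\Longrightarrow\quad\Sigma_{\mathcal X}^n\cong\mathbf 0\quad\Longrightarrow\quad\mathcal X=\bigcap_{i=1}^{n}\mathcal X^{\perp_i}.$$ (2) If $\mathcal X=\operatorname{add}\mathcal X$ is a strongly contravariantly finite and $n$-rigid subcategory, then $$\mathcal X=\bigcap_{i=1}^{n}\mathcal X^{\perp_i}\quad\Longrightarrow\quad\Omega_{\mathcal X}^n\cong\mathbf 0\quad\Longrightarrow\quad\mathcal X=\bigcap_{i=1}^{n}{}^{\perp_i}\mathcal X.$$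
   Context: Conventions: all categories are additive; subcategories are full and closed under isomorphisms; $\mathcal X=\operatorname{add}\mathcal X$ means $\mathcal X$ is closed under finite direct sums and direct summands; a category is small if its objects and morphisms form sets. Extriangulated categories $(\mathcal C,\mathbb E,\mathfrak s)$ are in the sense of Nakaoka--Palu; an $\mathbb E$-triangle is written $A\to B\to C\dashrightarrow$ and realizes an element of $\mathbb E(C,A)$. $R$-linear means that $\mathcal C$ is $R$-linear and $\mathbb E$ is an $R$-bilinear bifunctor $\mathcal C^{\mathrm{op}}\times\mathcal C\to R\text{-Mod}$. Positive higher extensions (Gorsky--Nakaoka--Palu): $\mathbb E^1=\mathbb E$ and $\mathbb E^i=\mathbb E^{\diamond i}$ is the $i$-fold tensor product of the $\mathcal C$-bimodule $\mathbb E$ over $\mathcal C$, i.e. $\mathbb E^{i}(C,A)=\int^{M\in\mathcal C}\mathbb E^{i-1}(C,M)\otimes_R\mathbb E(M,A)$. It is known that each $\mathbb E$-triangle induces long exact sequences $\mathcal C(X,A)\to\mathcal C(X,B)\to\mathcal C(X,C)\to\mathbb E(X,A)\to\mathbb E(X,B)\to\mathbb E(X,C)\to\mathbb E^2(X,A)\to\cdots$ and the contravariant analogue. $\mathcal X$ is $n$-rigid if $\mathbb E^i(X,X')=0$ for all $X,X'\in\mathcal X$ and $1\le i\le n$. For $i\ge1$, ${}^{\perp_i}\mathcal X=\{A\mid \mathbb E^i(A,X)=0\ \forall X\in\mathcal X\}$ and $\mathcal X^{\perp_i}=\{A\mid \mathbb E^i(X,A)=0\ \forall X\in\mathcal X\}$.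 A left $\mathcal X$-approximation of $A$ is a morphism $x_A:A\to X_A$ with $X_A\in\mathcal X$ through which every morphism from $A$ to an object of $\mathcal X$ factors; right approximations are dual. $\mathcal X$ is strongly covariantly finite if each $A\in\mathcal C$ admits an $\mathbb E$-triangle $A\xrightarrow{x_A}X_A\to A^+\dashrightarrow$ with $x_A$ a left $\mathcal X$-approximation; strongly contravariantly finite is dual: each $A$ admits an $\mathbb E$-triangle $A^-\to X^A\to A\dashrightarrow$ whose second morphism is a right $\mathcal X$-approximation. $\mathcal C/[\mathcal X]$ is the ideal quotient by the morphisms factoring through objects of $\mathcal X$, with quotient functor $\pi_{\mathcal X}$. If $\mathcal X$ is strongly covariantly finite, the canonical suspension $\Sigma_{\mathcal X}:\mathcal C/[\mathcal X]\to\mathcal C/[\mathcal X]$ is given by $\Sigma_{\mathcal X}(\pi_{\mathcal X}A)=\pi_{\mathcal X}(A^+)$ for chosen left approximation $\mathbb E$-triangles; on $f:A\to B$ one completes $f$ to a morphism $(f,g,h)$ of the chosen $\mathbb E$-triangles and sets $\Sigma_{\mathcal X}(\pi_{\mathcal X}f)=\pi_{\mathcal X}h$ (well defined, and independent of choices up to natural isomorphism). If $\mathcal X$ is strongly contravariantly finite, the canonical loop $\Omega_{\mathcal X}$ is defined dually, with $\Omega_{\mathcal X}(\pi_{\mathcal X}A)=\pi_{\mathcal X}(A^-)$. $\mathbf 0$ denotes the zero endofunctor. *)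

(* Defs.v *)
From HB Require Import structures.
From mathcomp Require Import all_boot all_algebra.
From mathcomp Require Import boolp classical_sets.

Set Implicit Arguments.
Unset Strict Implicit.
Unset Printing Implicit Defensive.

Import GRing.Theory.
Local Open Scope ring_scope.
Local Open Scope quotient_scope.

(* A presentation of an R-module: a type of expressions with formal operations
   satisfying the module axioms only up to the congruence [pm_eqv].  The module
   [pm_quot P] of its classes serves both for the Hom-modules of ideal quotients
   and for coends. *)
Record premod (R : pzRingType) := Premod {
  pm_sort :> Type;
  pm_eqv : pm_sort -> pm_sort -> Prop;
  pm_zero : pm_sort;
  pm_add : pm_sort -> pm_sort -> pm_sort;
  pm_opp : pm_sort -> pm_sort;
  pm_scale : R -> pm_sort -> pm_sort;
  pm_refl : forall x, pm_eqv x x;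
  pm_sym : forall x y, pm_eqv x y -> pm_eqv y x;
  pm_trans : forall y x z, pm_eqv x y -> pm_eqv y z -> pm_eqv x z;
  pm_addE : forall x x' y y', pm_eqv x x' -> pm_eqv y y' ->
    pm_eqv (pm_add x y) (pm_add x' y');
  pm_oppE : forall x x', pm_eqv x x' -> pm_eqv (pm_opp x) (pm_opp x');
  pm_scaleE : forall a x x', pm_eqv x x' ->
    pm_eqv (pm_scale a x) (pm_scale a x');
  pm_addA : forall x y z,
    pm_eqv (pm_add x (pm_add y z)) (pm_add (pm_add x y) z);
  pm_addC : forall x y, pm_eqv (pm_add x y) (pm_add y x);
  pm_add0 : forall x, pm_eqv (pm_add pm_zero x) x;
  pm_addN : forall x, pm_eqv (pm_add (pm_opp x) x) pm_zero;
  pm_scaleA : forall a b x,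
    pm_eqv (pm_scale a (pm_scale b x)) (pm_scale (a * b) x);
  pm_scale1 : forall x, pm_eqv (pm_scale 1 x) x;
  pm_scaleDr : forall a x y,
    pm_eqv (pm_scale a (pm_add x y)) (pm_add (pm_scale a x) (pm_scale a y));
  pm_scaleDl : forall x a b,
    pm_eqv (pm_scale (a + b) x) (pm_add (pm_scale a x) (pm_scale b x)) }.

Section PremodQuotient.
Context {R : pzRingType} (P : premod R).

Definition pm_rel (x y : {classic P}) : bool := `[< pm_eqv (x : P) (y : P) >].

Lemma pm_rel_refl : reflexive pm_rel.
Proof. by move=> x; apply/asboolP/pm_refl. Qed.

Lemma pm_rel_sym : symmetric pm_rel.
Proof. by move=> x y; apply/asboolP/asboolP => /pm_sym. Qed.

Lemma pm_rel_trans : transitive pm_rel.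
Proof.
by move=> y x z /asboolP xy /asboolP yz; apply/asboolP; apply: pm_trans xy yz.
Qed.

Canonical pm_equiv := EquivRel pm_rel pm_rel_refl pm_rel_sym pm_rel_trans.

Definition pm_quot : Type := {eq_quot pm_equiv}.
HB.instance Definition _ := Choice.on pm_quot.

Definition pm_cls (x : P) : pm_quot := \pi_{eq_quot pm_equiv} (x : {classic P}).
Definition pm_repr (q : pm_quot) : P := repr (q : {eq_quot pm_equiv}).

Lemma pm_clsK (q : pm_quot) : pm_cls (pm_repr q) = q.
Proof. exact: reprK. Qed.

Lemma pm_clsP (x y : P) : pm_cls x = pm_cls y <-> pm_eqv x y.
Proof.
split=> [xy | xy]; last by apply/eqmodP/asboolP.
by apply/asboolP; move/eqmodP: xy.
Qed.

Lemma pm_reprK (x : P) : pm_eqv (pm_repr (pm_cls x)) x.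
Proof. by apply/pm_clsP; rewrite pm_clsK. Qed.

Definition pmq_zero : pm_quot := pm_cls (pm_zero P).
Definition pmq_add (p q : pm_quot) : pm_quot :=
  pm_cls (pm_add (pm_repr p) (pm_repr q)).
Definition pmq_opp (p : pm_quot) : pm_quot := pm_cls (pm_opp (pm_repr p)).
Definition pmq_scale (a : R) (p : pm_quot) : pm_quot :=
  pm_cls (pm_scale a (pm_repr p)).

Lemma pmq_addE x y : pmq_add (pm_cls x) (pm_cls y) = pm_cls (pm_add x y).
Proof. by apply/pm_clsP/pm_addE; apply: pm_reprK. Qed.

Lemma pmq_oppE x : pmq_opp (pm_cls x) = pm_cls (pm_opp x).
Proof. by apply/pm_clsP/pm_oppE/pm_reprK. Qed.

Lemma pmq_scaleE a x : pmq_scale a (pm_cls x) = pm_cls (pm_scale a x).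
Proof. by apply/pm_clsP/pm_scaleE/pm_reprK. Qed.

Lemma pmq_addA : associative pmq_add.
Proof.
move=> p q r; rewrite -(pm_clsK p) -(pm_clsK q) -(pm_clsK r) !pmq_addE.
exact/pm_clsP/pm_addA.
Qed.

Lemma pmq_addC : commutative pmq_add.
Proof.
by move=> p q; rewrite -(pm_clsK p) -(pm_clsK q) !pmq_addE; apply/pm_clsP/pm_addC.
Qed.

Lemma pmq_add0 : left_id pmq_zero pmq_add.
Proof. by move=> p; rewrite -(pm_clsK p) pmq_addE; apply/pm_clsP/pm_add0. Qed.

Lemma pmq_addN : left_inverse pmq_zero pmq_opp pmq_add.
Proof.
by move=> p; rewrite -(pm_clsK p) pmq_oppE pmq_addE; apply/pm_clsP/pm_addN.
Qed.

HB.instance Definition _ :=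
  GRing.isZmodule.Build pm_quot pmq_addA pmq_addC pmq_add0 pmq_addN.

Lemma pmq_scaleA a b (p : pm_quot) :
  pmq_scale a (pmq_scale b p) = pmq_scale (a * b) p.
Proof. by rewrite -(pm_clsK p) !pmq_scaleE; apply/pm_clsP/pm_scaleA. Qed.

Lemma pmq_scale1 : left_id 1 pmq_scale.
Proof. by move=> p; rewrite -(pm_clsK p) pmq_scaleE; apply/pm_clsP/pm_scale1. Qed.

Lemma pmq_scaleDr : right_distributive pmq_scale +%R.
Proof.
move=> a p q.
change (pmq_scale a (pmq_add p q) = pmq_add (pmq_scale a p) (pmq_scale a q)).
rewrite -(pm_clsK p) -(pm_clsK q) pmq_addE !pmq_scaleE pmq_addE.
exact/pm_clsP/pm_scaleDr.
Qed.

Lemma pmq_scaleDl (p : pm_quot) : {morph pmq_scale^~ p : a b / a + b}.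
Proof.
move=> a b.
change (pmq_scale (a + b) p = pmq_add (pmq_scale a p) (pmq_scale b p)).
rewrite -(pm_clsK p) !pmq_scaleE pmq_addE.
exact/pm_clsP/pm_scaleDl.
Qed.

HB.instance Definition _ := GRing.Zmodule_isLmodule.Build R pm_quot
  pmq_scaleA pmq_scale1 pmq_scaleDr pmq_scaleDl.

Lemma pm_cls0 : pm_cls (pm_zero P) = 0. Proof. by []. Qed.
Lemma pm_clsD x y : pm_cls (pm_add x y) = pm_cls x + pm_cls y.
Proof. by rewrite -pmq_addE. Qed.
Lemma pm_clsN x : pm_cls (pm_opp x) = - pm_cls x.
Proof. by rewrite -pmq_oppE. Qed.
Lemma pm_clsZ a x : pm_cls (pm_scale a x) = a *: pm_cls x.
Proof. by rewrite -pmq_scaleE. Qed.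

End PremodQuotient.

(* Objects form a type and morphisms form R-modules living in types, so these
   categories are small. *)
Record addCat (R : comPzRingType) := AddCat {
  obj :> Type;
  hom : obj -> obj -> lmodType R;
  idc : forall A, hom A A;
  comp : forall A B D, hom B D -> hom A B -> hom A D;
  compA : forall A B D F (h : hom D F) (g : hom B D) (f : hom A B),
    comp h (comp g f) = comp (comp h g) f;
  comp1l : forall A B (f : hom A B), comp (idc B) f = f;
  comp1r : forall A B (f : hom A B), comp f (idc A) = f;
  compDl : forall A B D (g g' : hom B D) (f : hom A B),
    comp (g + g') f = comp g f + comp g' f;
  compDr : forall A B D (g : hom B D) (f f' : hom A B),
    comp g (f + f') = comp g f + comp g f';
  compZl : forall A B D a (g : hom B D) (f : hom A B),
    comp (a *: g) f = a *: comp g f;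
  compZr : forall A B D a (g : hom B D) (f : hom A B),
    comp g (a *: f) = a *: comp g f;
  zobj : obj;
  zobj_init : forall A (f : hom zobj A), f = 0;
  zobj_term : forall A (f : hom A zobj), f = 0;
  dsum : obj -> obj -> obj;
  inl_ : forall A B, hom A (dsum A B);
  inr_ : forall A B, hom B (dsum A B);
  prl_ : forall A B, hom (dsum A B) A;
  prr_ : forall A B, hom (dsum A B) B;
  prl_inl : forall A B, comp (prl_ A B) (inl_ A B) = idc A;
  prr_inr : forall A B, comp (prr_ A B) (inr_ A B) = idc B;
  prr_inl : forall A B, comp (prr_ A B) (inl_ A B) = 0;
  prl_inr : forall A B, comp (prl_ A B) (inr_ A B) = 0;
  dsum_id : forall A B,
    comp (inl_ A B) (prl_ A B) + comp (inr_ A B) (prr_ A B) = idc (dsum A B) }.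

Arguments hom {R _}.
Arguments idc {R _} A.
Arguments comp {R _ A B D}.
Arguments zobj {R}.
Arguments dsum {R _}.
Arguments inl_ {R _ A B}.
Arguments inr_ {R _ A B}.
Arguments prl_ {R _ A B}.
Arguments prr_ {R _ A B}.

Reserved Notation "g \oc f" (at level 40, left associativity).
Notation "g \oc f" := (comp g f) : ring_scope.

Section AddCatTheory.
Context {R : comPzRingType} {C : addCat R}.
Implicit Types A B D : C.

Lemma comp0l A B D (f : hom A B) : (0 : hom B D) \oc f = 0.
Proof. by rewrite -[X in X \oc f](scale0r 0) compZl scale0r. Qed.

Lemma comp0r A B D (g : hom B D) : g \oc (0 : hom A B) = 0.
Proof. by rewrite -[X in g \oc X](scale0r 0) compZr scale0r. Qed.

Lemma compNl A B D (g : hom B D) (f : hom A B) : (- g) \oc f = - (g \oc f).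
Proof. by rewrite -scaleN1r compZl scaleN1r. Qed.

Lemma compNr A B D (g : hom B D) (f : hom A B) : g \oc (- f) = - (g \oc f).
Proof. by rewrite -scaleN1r compZr scaleN1r. Qed.

Lemma compBl A B D (g g' : hom B D) (f : hom A B) :
  (g - g') \oc f = g \oc f - g' \oc f.
Proof. by rewrite compDl compNl. Qed.

Lemma compBr A B D (g : hom B D) (f f' : hom A B) :
  g \oc (f - f') = g \oc f - g \oc f'.
Proof. by rewrite compDr compNr. Qed.

Definition is_iso A B (f : hom A B) : Prop :=
  exists g : hom B A, g \oc f = idc A /\ f \oc g = idc B.

Definition isomorphic A B : Prop := exists f : hom A B, is_iso f.

Definition dsum_map A A' B B' (f : hom A B) (f' : hom A' B') :
    hom (dsum A A') (dsum B B') :=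
  inl_ \oc f \oc prl_ + inr_ \oc f' \oc prr_.

End AddCatTheory.

Record functor (R : comPzRingType) (C D : addCat R) := Functor {
  fobj :> C -> D;
  fmap : forall A B : C, hom A B -> hom (fobj A) (fobj B);
  fmap_id : forall A, fmap (idc A) = idc (fobj A);
  fmap_comp : forall A B E (g : hom B E) (f : hom A B),
    fmap (g \oc f) = fmap g \oc fmap f }.

Arguments fmap {R C D} F {A B} : rename.

Section Functors.
Context {R : comPzRingType}.

Definition id_functor (C : addCat R) : functor C C :=
  @Functor R C C id (fun _ _ => id) (fun _ => erefl) (fun _ _ _ _ _ => erefl).

Section Comp.
Context {C D E : addCat R} (G : functor D E) (F : functor C D).

Lemma fcomp_id A : fmap G (fmap F (idc A)) = idc (G (F A)).
Proof. by rewrite !fmap_id. Qed.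

Lemma fcomp_comp A B A' (g : hom B A') (f : hom A B) :
  fmap G (fmap F (g \oc f)) = fmap G (fmap F g) \oc fmap G (fmap F f).
Proof. by rewrite !fmap_comp. Qed.

Definition functor_comp : functor C E :=
  @Functor R C E (fun A => G (F A)) (fun _ _ f => fmap G (fmap F f))
    fcomp_id fcomp_comp.

End Comp.

Fixpoint functor_pow (C : addCat R) (F : functor C C) (n : nat) : functor C C :=
  if n is m.+1 then functor_comp F (functor_pow F m) else id_functor C.

Lemma zero_functor_id (C D : addCat R) (A : C) : 0 = idc (zobj D).
Proof. by rewrite (zobj_init (idc (zobj D))). Qed.

Lemma zero_functor_comp (C D : addCat R) (A B E : C)
    (g : hom B E) (f : hom A B) :
  (0 : hom (zobj D) (zobj D)) = (0 : hom (zobj D) (zobj D)) \oc 0.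
Proof. by rewrite comp0l. Qed.

Definition zero_functor (C D : addCat R) : functor C D :=
  @Functor R C D (fun _ => zobj D) (fun _ _ _ => 0)
    (@zero_functor_id C D) (@zero_functor_comp C D).

Definition nat_iso (C D : addCat R) (F G : functor C D) : Prop :=
  exists eta : forall A : C, hom (F A) (G A),
    (forall A B (f : hom A B), eta B \oc fmap F f = fmap G f \oc eta A)
    /\ (forall A, is_iso (eta A)).

End Functors.

(* Subcategories X = add X; full subcategories are given by their objects. *)
Record subcat (R : comPzRingType) (C : addCat R) := Subcat {
  smem :> C -> Prop;
  sub_iso : forall A B : C, isomorphic A B -> smem A -> smem B;
  sub_zero : smem (zobj C);
  sub_dsum : forall A B : C, smem A -> smem B -> smem (dsum A B);
  sub_summand : forall A B : C, smem (dsum A B) -> smem A }.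

Section IdealQuotient.
Context {R : comPzRingType} {C : addCat R} (X : subcat C).
Implicit Types A B D : C.

Definition factors A B (f : hom A B) : Prop :=
  exists2 M : C, X M & exists (g : hom A M) (h : hom M B), f = h \oc g.

Lemma factors0 A B : factors (0 : hom A B).
Proof.
by exists (zobj C); [exact: sub_zero | exists 0, 0; rewrite comp0l].
Qed.

Lemma factorsZ A B a (f : hom A B) : factors f -> factors (a *: f).
Proof. by case=> M XM [g [h ->]]; exists M => //; exists g, (a *: h); rewrite compZl. Qed.

Lemma factorsD A B (f f' : hom A B) :
  factors f -> factors f' -> factors (f + f').
Proof.
case=> M XM [g [h ->]] [M' XM' [g' [h' ->]]].
exists (dsum M M'); first exact: sub_dsum.
exists (inl_ \oc g + inr_ \oc g'), (h \oc prl_ + h' \oc prr_).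
rewrite compDr !compDl -!compA !(compA prl_) !(compA prr_).
rewrite prl_inl prl_inr prr_inl prr_inr !comp1l !comp0l !comp0r.
by rewrite addr0 add0r.
Qed.

Lemma factors_compl A B D (g : hom B D) (f : hom A B) :
  factors f -> factors (g \oc f).
Proof. by case=> M XM [u [v ->]]; exists M => //; exists u, (g \oc v); rewrite compA. Qed.

Lemma factors_compr A B D (g : hom B D) (f : hom A B) :
  factors g -> factors (g \oc f).
Proof. by case=> M XM [u [v ->]]; exists M => //; exists (u \oc f), v; rewrite compA. Qed.

Definition ideal_eqv A B (f f' : hom A B) : Prop := factors (f - f').

Lemma ideal_eqv_eq A B (f f' : hom A B) : f = f' -> ideal_eqv f f'.
Proof. by move=> ->; rewrite /ideal_eqv subrr; apply: factors0. Qed.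

Lemma ideal_eqv_sym A B (f f' : hom A B) : ideal_eqv f f' -> ideal_eqv f' f.
Proof. by rewrite /ideal_eqv => /(factorsZ (-1)); rewrite scaleN1r opprB. Qed.

Lemma ideal_eqv_trans A B (f' f f'' : hom A B) :
  ideal_eqv f f' -> ideal_eqv f' f'' -> ideal_eqv f f''.
Proof.
by rewrite /ideal_eqv => p q; have := factorsD p q; rewrite addrA subrK.
Qed.

Lemma ideal_eqvD A B (f f' g g' : hom A B) :
  ideal_eqv f f' -> ideal_eqv g g' -> ideal_eqv (f + g) (f' + g').
Proof.
rewrite /ideal_eqv => p q; have := factorsD p q.
by rewrite opprD addrACA.
Qed.

Lemma ideal_eqvZ A B a (f f' : hom A B) :
  ideal_eqv f f' -> ideal_eqv (a *: f) (a *: f').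
Proof. by rewrite /ideal_eqv -scalerBr; apply: factorsZ. Qed.

Lemma ideal_eqvN A B (f f' : hom A B) :
  ideal_eqv f f' -> ideal_eqv (- f) (- f').
Proof. by move=> /(ideal_eqvZ (-1)); rewrite !scaleN1r. Qed.

Lemma ideal_eqv_comp A B D (g g' : hom B D) (f f' : hom A B) :
  ideal_eqv g g' -> ideal_eqv f f' -> ideal_eqv (g \oc f) (g' \oc f').
Proof.
rewrite /ideal_eqv => p q.
have := factorsD (factors_compr f p) (factors_compl g' q).
by rewrite compBl compBr addrA subrK.
Qed.

Definition ideal_premod A B : premod R.
Proof.
refine (@Premod R (hom A B) (@ideal_eqv A B) 0 +%R -%R *:%R _ _ _ _ _ _
  _ _ _ _ _ _ _ _) => *.
- exact: ideal_eqv_eq.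
- exact: ideal_eqv_sym.
- by apply: ideal_eqv_trans; eassumption.
- exact: ideal_eqvD.
- exact: ideal_eqvN.
- exact: ideal_eqvZ.
- by apply: ideal_eqv_eq; rewrite addrA.
- by apply: ideal_eqv_eq; rewrite addrC.
- by apply: ideal_eqv_eq; rewrite add0r.
- by apply: ideal_eqv_eq; rewrite addNr.
- by apply: ideal_eqv_eq; rewrite scalerA.
- by apply: ideal_eqv_eq; rewrite scale1r.
- by apply: ideal_eqv_eq; rewrite scalerDr.
- by apply: ideal_eqv_eq; rewrite scalerDl.
Defined.

Definition qhom A B : lmodType R := pm_quot (ideal_premod A B).

Definition qpi A B (f : hom A B) : qhom A B := pm_cls (f : ideal_premod A B).
Definition qrepr A B (q : qhom A B) : hom A B := pm_repr q.

Lemma qreprK A B (q : qhom A B) : qpi (qrepr q) = q.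
Proof. exact: pm_clsK. Qed.

Lemma qpiP A B (f f' : hom A B) : qpi f = qpi f' <-> factors (f - f').
Proof. exact: (@pm_clsP _ (ideal_premod A B)). Qed.

Lemma qpiK A B (f : hom A B) : factors (qrepr (qpi f) - f).
Proof. by apply/qpiP; rewrite qreprK. Qed.

Lemma qpi0 A B : qpi (0 : hom A B) = 0. Proof. by []. Qed.
Lemma qpiD A B (f f' : hom A B) : qpi (f + f') = qpi f + qpi f'.
Proof. exact: (@pm_clsD _ (ideal_premod A B)). Qed.
Lemma qpiZ A B a (f : hom A B) : qpi (a *: f) = a *: qpi f.
Proof. exact: (@pm_clsZ _ (ideal_premod A B)). Qed.

Definition qcomp A B D (g : qhom B D) (f : qhom A B) : qhom A D :=
  qpi (qrepr g \oc qrepr f).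

Lemma qcompE A B D (g : hom B D) (f : hom A B) :
  qcomp (qpi g) (qpi f) = qpi (g \oc f).
Proof. by apply/qpiP; apply: ideal_eqv_comp; apply: qpiK. Qed.

Lemma qind A B (P : qhom A B -> Prop) : (forall f, P (qpi f)) -> forall q, P q.
Proof. by move=> H q; rewrite -(qreprK q). Qed.

Definition quot_cat : addCat R.
Proof.
refine (@AddCat R C qhom (fun A => qpi (idc A)) qcomp _ _ _ _ _ _ _
  (zobj C) _ _ (@dsum R C) (fun A B => qpi inl_) (fun A B => qpi inr_)
  (fun A B => qpi prl_) (fun A B => qpi prr_) _ _ _ _ _).
- move=> A B D F; elim/qind=> h; elim/qind=> g; elim/qind=> f.
  by rewrite !qcompE compA.
- by move=> A B; elim/qind=> f; rewrite qcompE comp1l.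
- by move=> A B; elim/qind=> f; rewrite qcompE comp1r.
- move=> A B D; elim/qind=> g; elim/qind=> g'; elim/qind=> f.
  by rewrite -qpiD !qcompE compDl qpiD.
- move=> A B D; elim/qind=> g; elim/qind=> f; elim/qind=> f'.
  by rewrite -qpiD !qcompE compDr qpiD.
- move=> A B D a; elim/qind=> g; elim/qind=> f.
  by rewrite -qpiZ !qcompE compZl qpiZ.
- move=> A B D a; elim/qind=> g; elim/qind=> f.
  by rewrite -qpiZ !qcompE compZr qpiZ.
- by move=> A; elim/qind=> f; rewrite (zobj_init f).
- by move=> A; elim/qind=> f; rewrite (zobj_term f).
- by move=> A B; rewrite qcompE prl_inl.
- by move=> A B; rewrite qcompE prr_inr.
- by move=> A B; rewrite qcompE prr_inl.
- by move=> A B; rewrite qcompE prl_inr.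
- by move=> A B; rewrite !qcompE -qpiD dsum_id.
Defined.

Definition quot_functor : functor C quot_cat :=
  @Functor R C quot_cat id qpi (fun _ => erefl)
    (fun _ _ _ g f => esym (qcompE g f)).

End IdealQuotient.

(* R-bilinear bifunctors C^op x C -> R-Mod; [bval E D A] is E(D, A), contravariant
   in D and covariant in A. *)
Record bimod (R : comPzRingType) (C : addCat R) := Bimod {
  bval :> C -> C -> lmodType R;
  push : forall D A B, hom A B -> bval D A -> bval D B;
  pull : forall D' D A, hom D' D -> bval D A -> bval D' A;
  push_id : forall D A (e : bval D A), push (idc A) e = e;
  push_comp : forall D A B B' (g : hom B B') (f : hom A B) (e : bval D A),
    push (g \oc f) e = push g (push f e);
  pull_id : forall D A (e : bval D A), pull (idc D) e = e;
  pull_comp : forall D'' D' D A (g : hom D' D) (f : hom D'' D') (e : bval D A),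
    pull (g \oc f) e = pull f (pull g e);
  push_pull : forall D' D A B (f : hom A B) (g : hom D' D) (e : bval D A),
    push f (pull g e) = pull g (push f e);
  pushD : forall D A B (f : hom A B) (e e' : bval D A),
    push f (e + e') = push f e + push f e';
  pushZ : forall D A B (f : hom A B) a (e : bval D A),
    push f (a *: e) = a *: push f e;
  pullD : forall D' D A (g : hom D' D) (e e' : bval D A),
    pull g (e + e') = pull g e + pull g e';
  pullZ : forall D' D A (g : hom D' D) a (e : bval D A),
    pull g (a *: e) = a *: pull g e;
  pushDl : forall D A B (f f' : hom A B) (e : bval D A),
    push (f + f') e = push f e + push f' e;
  pushZl : forall D A B a (f : hom A B) (e : bval D A),
    push (a *: f) e = a *: push f e;
  pullDl : forall D' D A (g g' : hom D' D) (e : bval D A),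
    pull (g + g') e = pull g e + pull g' e;
  pullZl : forall D' D A a (g : hom D' D) (e : bval D A),
    pull (a *: g) e = a *: pull g e }.

Arguments push {R C} b {D A B}.
Arguments pull {R C} b {D' D A}.

Section BimodTheory.
Context {R : comPzRingType} {C : addCat R} (E : bimod C).

Lemma push0 (D A B : C) (f : hom A B) : push E f (0 : E D A) = 0.
Proof. by rewrite -[X in push E f X](scale0r 0) pushZ scale0r. Qed.

Lemma pull0 (D' D A : C) (g : hom D' D) : pull E g (0 : E D A) = 0.
Proof. by rewrite -[X in pull E g X](scale0r 0) pullZ scale0r. Qed.

Lemma push0l (D A B : C) (e : E D A) : push E (0 : hom A B) e = 0.
Proof. by rewrite -[X in push E X](scale0r 0) pushZl scale0r. Qed.

Lemma pull0l (D' D A : C) (e : E D A) : pull E (0 : hom D' D) e = 0.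
Proof. by rewrite -[X in pull E X](scale0r 0) pullZl scale0r. Qed.

Lemma pushBl (D A B : C) (f f' : hom A B) (e : E D A) :
  push E (f - f') e = push E f e - push E f' e.
Proof. by rewrite pushDl -scaleN1r pushZl scaleN1r. Qed.

Lemma pullBl (D' D A : C) (g g' : hom D' D) (e : E D A) :
  pull E (g - g') e = pull E g e - pull E g' e.
Proof. by rewrite pullDl -scaleN1r pullZl scaleN1r. Qed.

End BimodTheory.

Definition hom_bimod (R : comPzRingType) (C : addCat R) : bimod C.
Proof.
refine (@Bimod R C (@hom R C) (fun D A B f e => f \oc e)
  (fun D' D A g e => e \oc g) _ _ _ _ _ _ _ _ _ _ _ _ _) => *.
- exact: comp1l.
- by rewrite compA.
- exact: comp1r.
- exact: compA.
- exact: compA.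
- exact: compDr.
- exact: compZr.
- exact: compDl.
- exact: compZl.
- exact: compDl.
- exact: compZl.
- exact: compDr.
- exact: compZr.
Defined.

(* The module (F <> G)(A, B), i.e. the coend over M of F(A, M) (x)_R G(M, B),
   presented by generators [TGen M x y] (standing for x (x) y) and relations:
   R-bilinearity and F(A, f) x (x) y ~ x (x) G(f, B) y for f : M -> M'. *)
Section TensorModule.
Context {R : comPzRingType} {C : addCat R} (F G : bimod C) (A B : C).

Inductive tterm : Type :=
| TGen (M : C) (x : F A M) (y : G M B)
| TZero
| TAdd (s t : tterm)
| TOpp (t : tterm)
| TScale (a : R) (t : tterm).

Inductive teqv : tterm -> tterm -> Prop :=
| teqv_refl t : teqv t t
| teqv_sym s t : teqv s t -> teqv t s
| teqv_trans t s u : teqv s t -> teqv t u -> teqv s u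
| teqv_add s s' t t' : teqv s s' -> teqv t t' -> teqv (TAdd s t) (TAdd s' t')
| teqv_opp t t' : teqv t t' -> teqv (TOpp t) (TOpp t')
| teqv_scale a t t' : teqv t t' -> teqv (TScale a t) (TScale a t')
| teqv_addA s t u : teqv (TAdd s (TAdd t u)) (TAdd (TAdd s t) u)
| teqv_addC s t : teqv (TAdd s t) (TAdd t s)
| teqv_add0 t : teqv (TAdd TZero t) t
| teqv_addN t : teqv (TAdd (TOpp t) t) TZero
| teqv_scaleA a b t : teqv (TScale a (TScale b t)) (TScale (a * b) t)
| teqv_scale1 t : teqv (TScale 1 t) t
| teqv_scaleDr a s t :
    teqv (TScale a (TAdd s t)) (TAdd (TScale a s) (TScale a t))
| teqv_scaleDl t a b : teqv (TScale (a + b) t) (TAdd (TScale a t) (TScale b t))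
| teqv_genDl M (x x' : F A M) (y : G M B) :
    teqv (TGen (x + x') y) (TAdd (TGen x y) (TGen x' y))
| teqv_genDr M (x : F A M) (y y' : G M B) :
    teqv (TGen x (y + y')) (TAdd (TGen x y) (TGen x y'))
| teqv_genZl M a (x : F A M) (y : G M B) :
    teqv (TGen (a *: x) y) (TScale a (TGen x y))
| teqv_genZr M a (x : F A M) (y : G M B) :
    teqv (TGen x (a *: y)) (TScale a (TGen x y))
| teqv_balanced M M' (f : hom M M') (x : F A M) (y : G M' B) :
    teqv (TGen (push F f x) y) (TGen x (pull G f y)).

Definition tensor_premod : premod R :=
  @Premod R tterm teqv TZero TAdd TOpp TScale teqv_refl teqv_sym teqv_trans
    teqv_add teqv_opp teqv_scale teqv_addA teqv_addC teqv_add0 teqv_addN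
    teqv_scaleA teqv_scale1 teqv_scaleDr teqv_scaleDl.

Definition tensor_val : lmodType R := pm_quot tensor_premod.

Definition tpure (M : C) (x : F A M) (y : G M B) : tensor_val :=
  pm_cls (TGen x y : tensor_premod).

Lemma tpureDl M (x x' : F A M) (y : G M B) :
  tpure (x + x') y = tpure x y + tpure x' y.
Proof.
rewrite -(@pm_clsD _ tensor_premod); apply/pm_clsP; exact: teqv_genDl.
Qed.

Lemma tpureDr M (x : F A M) (y y' : G M B) :
  tpure x (y + y') = tpure x y + tpure x y'.
Proof.
rewrite -(@pm_clsD _ tensor_premod); apply/pm_clsP; exact: teqv_genDr.
Qed.

Lemma tpureZl M a (x : F A M) (y : G M B) : tpure (a *: x) y = a *: tpure x y.
Proof.
rewrite -(@pm_clsZ _ tensor_premod); apply/pm_clsP; exact: teqv_genZl.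
Qed.

Lemma tpureZr M a (x : F A M) (y : G M B) : tpure x (a *: y) = a *: tpure x y.
Proof.
rewrite -(@pm_clsZ _ tensor_premod); apply/pm_clsP; exact: teqv_genZr.
Qed.

Lemma tpure_balanced M M' (f : hom M M') (x : F A M) (y : G M' B) :
  tpure (push F f x) y = tpure x (pull G f y).
Proof. apply/pm_clsP; exact: teqv_balanced. Qed.

Lemma tensor_ind (P : tensor_val -> Prop) :
  (forall M (x : F A M) (y : G M B), P (tpure x y)) -> P 0 ->
  (forall s t, P s -> P t -> P (s + t)) ->
  (forall s, P s -> P (- s)) ->
  (forall a s, P s -> P (a *: s)) ->
  forall t, P t.
Proof.
move=> Pg P0 PD PN PZ t; rewrite -(pm_clsK t).
elim: (pm_repr t) => [M x y||s Ps s' Ps'|s Ps|a s Ps].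
- exact: Pg.
- exact: P0.
- by rewrite (@pm_clsD _ tensor_premod); apply: PD.
- by rewrite (@pm_clsN _ tensor_premod); apply: PN.
- by rewrite (@pm_clsZ _ tensor_premod); apply: PZ.
Qed.

Section Lift.
Context {V : lmodType R} (phi : forall M : C, F A M -> G M B -> V).

Definition balanced : Prop :=
  [/\ forall M (x x' : F A M) (y : G M B), phi (x + x') y = phi x y + phi x' y,
      forall M (x : F A M) (y y' : G M B), phi x (y + y') = phi x y + phi x y',
      forall M a (x : F A M) (y : G M B), phi (a *: x) y = a *: phi x y,
      forall M a (x : F A M) (y : G M B), phi x (a *: y) = a *: phi x y &
      forall M M' (f : hom M M') (x : F A M) (y : G M' B),
        phi (push F f x) y = phi x (pull G f y)].

Fixpoint teval (t : tterm) : V :=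
  match t with
  | TGen M x y => phi x y
  | TZero => 0
  | TAdd s t => teval s + teval t
  | TOpp t => - teval t
  | TScale a t => a *: teval t
  end.

Definition tlift (t : tensor_val) : V := teval (pm_repr t).

Context (phi_bal : balanced).

Lemma teval_eqv s t : teqv s t -> teval s = teval t.
Proof.
case: phi_bal => Dl Dr Zl Zr bal.
elim=> //= {s t}.
- by move=> t s u _ -> _ ->.
- by move=> s s' t t' _ -> _ ->.
- by move=> t t' _ ->.
- by move=> a t t' _ ->.
- by move=> s t u; rewrite addrA.
- by move=> s t; rewrite addrC.
- by move=> t; rewrite add0r.
- by move=> t; rewrite addNr.
- by move=> a b t; rewrite scalerA.
- by move=> t; rewrite scale1r.
- by move=> a s t; rewrite scalerDr.
- by move=> t a b; rewrite scalerDl.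
Qed.

Lemma tlift_cls (t : tensor_premod) : tlift (pm_cls t) = teval t.
Proof. by apply: teval_eqv; apply: (@pm_reprK _ tensor_premod). Qed.

Lemma tlift_pure M (x : F A M) (y : G M B) : tlift (tpure x y) = phi x y.
Proof. exact: tlift_cls. Qed.

Lemma tliftD s t : tlift (s + t) = tlift s + tlift t.
Proof.
by rewrite -(pm_clsK s) -(pm_clsK t) -(@pm_clsD _ tensor_premod) !tlift_cls.
Qed.

Lemma tliftZ a t : tlift (a *: t) = a *: tlift t.
Proof. by rewrite -(pm_clsK t) -(@pm_clsZ _ tensor_premod) !tlift_cls. Qed.

End Lift.

Lemma tensor_ext (V : lmodType R) (u v : tensor_val -> V) :
  (forall s t, u (s + t) = u s + u t) -> (forall a t, u (a *: t) = a *: u t) ->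
  (forall s t, v (s + t) = v s + v t) -> (forall a t, v (a *: t) = a *: v t) ->
  (forall M (x : F A M) (y : G M B), u (tpure x y) = v (tpure x y)) ->
  forall t, u t = v t.
Proof.
move=> uD uZ vD vZ uv; elim/tensor_ind => //.
- by rewrite -(scale0r 0) uZ vZ !scale0r.
- by move=> s t us ut; rewrite uD vD us ut.
- by move=> t ut; rewrite -scaleN1r uZ vZ ut.
- by move=> a t ut; rewrite uZ vZ ut.
Qed.

End TensorModule.

Section Tensor.
Context {R : comPzRingType} {C : addCat R} (F G : bimod C).
Implicit Types A B D : C.

Definition tpush D A B (f : hom A B) : tensor_val F G D A -> tensor_val F G D B :=
  tlift (fun M x y => tpure x (push G f y)).

Definition tpull D' D A (g : hom D' D) : tensor_val F G D A -> tensor_val F G D' A :=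
  tlift (fun M x y => tpure (pull F g x) y).

Lemma tpush_balanced D A B (f : hom A B) :
  balanced (fun M (x : F D M) (y : G M A) => tpure x (push G f y)).
Proof.
split=> *; rewrite ?pushD ?pushZ ?tpureDl ?tpureDr ?tpureZl ?tpureZr //.
by rewrite tpure_balanced push_pull.
Qed.

Lemma tpull_balanced D' D A (g : hom D' D) :
  balanced (fun M (x : F D M) (y : G M A) => tpure (pull F g x) y).
Proof.
split=> *; rewrite ?pullD ?pullZ ?tpureDl ?tpureDr ?tpureZl ?tpureZr //.
by rewrite -push_pull tpure_balanced.
Qed.

Lemma tpushE D A B (f : hom A B) M (x : F D M) (y : G M A) :
  tpush f (tpure x y) = tpure x (push G f y).
Proof. exact/tlift_pure/tpush_balanced. Qed.

Lemma tpullE D' D A (g : hom D' D) M (x : F D M) (y : G M A) :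
  tpull g (tpure x y) = tpure (pull F g x) y.
Proof. exact/tlift_pure/tpull_balanced. Qed.

Lemma tpushD D A B (f : hom A B) (s t : tensor_val F G D A) :
  tpush f (s + t) = tpush f s + tpush f t.
Proof. exact/tliftD/tpush_balanced. Qed.

Lemma tpushZ D A B (f : hom A B) a (t : tensor_val F G D A) :
  tpush f (a *: t) = a *: tpush f t.
Proof. exact/tliftZ/tpush_balanced. Qed.

Lemma tpullD D' D A (g : hom D' D) (s t : tensor_val F G D A) :
  tpull g (s + t) = tpull g s + tpull g t.
Proof. exact/tliftD/tpull_balanced. Qed.

Lemma tpullZ D' D A (g : hom D' D) a (t : tensor_val F G D A) :
  tpull g (a *: t) = a *: tpull g t.
Proof. exact/tliftZ/tpull_balanced. Qed.

Definition tensor : bimod C.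
Proof.
refine (@Bimod R C (@tensor_val R C F G) tpush tpull _ _ _ _ _
  tpushD tpushZ tpullD tpullZ _ _ _ _).
- move=> D A; apply: tensor_ext => *; rewrite ?tpushD ?tpushZ //.
  by rewrite tpushE push_id.
- move=> D A B B' g f; apply: tensor_ext => *; rewrite ?tpushD ?tpushZ //.
  by rewrite !tpushE push_comp.
- move=> D A; apply: tensor_ext => *; rewrite ?tpullD ?tpullZ //.
  by rewrite tpullE pull_id.
- move=> D'' D' D A g f; apply: tensor_ext => *; rewrite ?tpullD ?tpullZ //.
  by rewrite !tpullE pull_comp.
- move=> D' D A B f g; apply: tensor_ext => *;
    rewrite ?(tpullD, tpullZ, tpushD, tpushZ) //.
  by rewrite tpushE !tpullE tpushE.
- move=> D A B f f'; apply: tensor_ext => *;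
    rewrite ?tpushD ?tpushZ ?scalerDr //; first by rewrite addrACA.
  by rewrite !tpushE pushDl tpureDr.
- move=> D A B a f; apply: tensor_ext => *; rewrite ?tpushD ?tpushZ ?scalerDr //.
    by rewrite !scalerA mulrC.
  by rewrite !tpushE pushZl tpureZr.
- move=> D' D A g g'; apply: tensor_ext => *;
    rewrite ?tpullD ?tpullZ ?scalerDr //; first by rewrite addrACA.
  by rewrite !tpullE pullDl tpureDl.
- move=> D' D A a g; apply: tensor_ext => *; rewrite ?tpullD ?tpullZ ?scalerDr //.
    by rewrite !scalerA mulrC.
  by rewrite !tpullE pullZl tpureZl.
Defined.

End Tensor.

(* E^0 is the Hom bimodule, E^1 = E and E^(i+1) = E^i <> E. *)
Fixpoint bimod_pow (R : comPzRingType) (C : addCat R) (E : bimod C) (i : nat) :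
    bimod C :=
  match i with
  | 0 => hom_bimod C
  | 1 => E
  | j.+1 => tensor (bimod_pow E j) E
  end.

Definition seq_equiv (R : comPzRingType) (C : addCat R) (A B B' D : C)
    (x : hom A B) (y : hom B D) (x' : hom A B') (y' : hom B' D) : Prop :=
  exists b : hom B B', [/\ is_iso b, b \oc x = x' & y' \oc b = y].

(* Extriangulated categories of Nakaoka and Palu.  [realizes x y e] means that
   A -x-> B -y-> D belongs to the class s(e), for e in E(D, A); [real_ex] and
   [real_class] say that s(e) is exactly one class for [seq_equiv].  Then come:
   s is a realization, s(0) is the split class and s(e (+) e') = s(e) (+) s(e'),
   where e (+) e' in E(D (+) D', A (+) A') has components (e, 0, 0, e').
   In [ET4] the object M sits in
     A -f-> B -f'-> D                      D -d-> M -m-> F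
     |      g       d    and, in [ET4op],  |      h'     g'
     A -h-> G -h'-> M                      D -f'->A -f-> B
            g'      m                             h      g
            F  ==   F                             G  ==  G  *)
Record extriCat (R : comPzRingType) := ExtriCat {
  ecat :> addCat R;
  ext : bimod ecat;
  realizes : forall A B D : ecat, hom A B -> hom B D -> ext D A -> Prop;
  real_ex : forall (A D : ecat) (e : ext D A),
    exists (B : ecat) (x : hom A B) (y : hom B D), realizes x y e;
  real_class : forall (A B B' D : ecat) (e : ext D A)
      (x : hom A B) (y : hom B D) (x' : hom A B') (y' : hom B' D),
    realizes x y e -> (realizes x' y' e <-> seq_equiv x y x' y');
  real_map : forall (A B D A' B' D' : ecat) (e : ext D A) (e' : ext D' A')
      (x : hom A B) (y : hom B D) (x' : hom A' B') (y' : hom B' D')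
      (a : hom A A') (c : hom D D'),
    realizes x y e -> realizes x' y' e' -> push ext a e = pull ext c e' ->
    exists b : hom B B', b \oc x = x' \oc a /\ y' \oc b = c \oc y;
  real_zero : forall A D : ecat,
    realizes (inl_ : hom A (dsum A D)) (prr_ : hom (dsum A D) D) 0;
  real_dsum : forall (A B D A' B' D' : ecat) (e : ext D A) (e' : ext D' A')
      (x : hom A B) (y : hom B D) (x' : hom A' B') (y' : hom B' D'),
    realizes x y e -> realizes x' y' e' ->
    realizes (dsum_map x x') (dsum_map y y')
      (push ext inl_ (pull ext prl_ e) + push ext inr_ (pull ext prr_ e'));
  ET3 : forall (A B D A' B' D' : ecat) (e : ext D A) (e' : ext D' A')
      (x : hom A B) (y : hom B D) (x' : hom A' B') (y' : hom B' D')
      (a : hom A A') (b : hom B B'),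
    realizes x y e -> realizes x' y' e' -> b \oc x = x' \oc a ->
    exists c : hom D D', c \oc y = y' \oc b /\ push ext a e = pull ext c e';
  ET3op : forall (A B D A' B' D' : ecat) (e : ext D A) (e' : ext D' A')
      (x : hom A B) (y : hom B D) (x' : hom A' B') (y' : hom B' D')
      (b : hom B B') (c : hom D D'),
    realizes x y e -> realizes x' y' e' -> c \oc y = y' \oc b ->
    exists a : hom A A', b \oc x = x' \oc a /\ push ext a e = pull ext c e';
  ET4 : forall (A B D G F : ecat) (e : ext D A) (e' : ext F B)
      (f : hom A B) (f' : hom B D) (g : hom B G) (g' : hom G F),
    realizes f f' e -> realizes g g' e' ->
    exists (M : ecat) (h : hom A G) (h' : hom G M) (d : hom D M) (m : hom M F)
        (e'' : ext M A),
      [/\ h = g \oc f, h' \oc g = d \oc f' & m \oc h' = g']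
      /\ [/\ realizes h h' e'', realizes d m (push ext f' e'),
             pull ext d e'' = e & push ext f e'' = pull ext m e'];
  ET4op : forall (D A B F G : ecat) (e : ext B D) (e' : ext G F)
      (f' : hom D A) (f : hom A B) (g' : hom F B) (g : hom B G),
    realizes f' f e -> realizes g' g e' ->
    exists (M : ecat) (d : hom D M) (m : hom M F) (h' : hom M A) (h : hom A G)
        (e'' : ext G M),
      [/\ h = g \oc f, h' \oc d = f' & f \oc h' = g' \oc m]
      /\ [/\ realizes h' h e'', realizes d m (pull ext g' e),
             push ext m e'' = e' & push ext d e = pull ext g e''] }.

Arguments realizes {R e A B D} : rename.

Section ExtriTheory.
Context {R : comPzRingType} {C : extriCat R}.
Notation E := (ext C).

Definition Ext (i : nat) : bimod C := bimod_pow E i.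

Lemma real_comp0 (A B D : C) (x : hom A B) (y : hom B D) (e : E D A) :
  realizes x y e -> y \oc x = 0.
Proof.
move=> xye.
have [c [cE _]] := @ET3 R C _ _ _ _ _ _ _ _ _ _ _ _ (idc A)
  (x \oc prl_ : hom (dsum A (zobj C)) B) (real_zero A (zobj C)) xye
  ltac:(by rewrite -compA prl_inl).
have := congr1 (fun k => k \oc inl_) cE.
by rewrite -!compA prl_inl prr_inl comp0r comp1r => <-.
Qed.

Lemma real_push0 (A B D : C) (x : hom A B) (y : hom B D) (e : E D A) :
  realizes x y e -> push E x e = 0.
Proof.
move=> xye.
have [c [_ ->]] := @ET3 R C _ _ _ _ _ _ _ _ _ _ _ _ x (inl_ + inr_ \oc y)
  xye (real_zero B D)
  ltac:(by rewrite compDl -compA (real_comp0 xye) comp0r addr0).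
exact: pull0.
Qed.

Lemma real_pull0 (A B D : C) (x : hom A B) (y : hom B D) (e : E D A) :
  realizes x y e -> pull E y e = 0.
Proof.
move=> xye.
have [a [_ <-]] := @ET3op R C _ _ _ _ _ _ _ _ _ _ _ _ (x \oc prl_ + prr_) y
  (real_zero A B) xye
  ltac:(by rewrite compDr compA (real_comp0 xye) comp0l add0r).
exact: push0.
Qed.

Lemma pull0_factor (A B D M : C) (x : hom A B) (y : hom B D) (e : E D A)
    (c : hom M D) :
  realizes x y e -> pull E c e = 0 -> exists u : hom M B, c = y \oc u.
Proof.
move=> xye ce0.
have [b [_ bE]] := @real_map R C _ _ _ _ _ _ _ _ _ _ _ _ (idc A) c
  (real_zero A M) xye ltac:(by rewrite push0 ce0).
by exists (b \oc inr_); rewrite compA bE -compA prr_inr comp1r.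
Qed.

Lemma push0_factor (A B D M : C) (x : hom A B) (y : hom B D) (e : E D A)
    (a : hom A M) :
  realizes x y e -> push E a e = 0 -> exists u : hom B M, a = u \oc x.
Proof.
move=> xye ae0.
have [b [bE _]] := @real_map R C _ _ _ _ _ _ _ _ _ _ _ _ a (idc D)
  xye (real_zero M D) ltac:(by rewrite pull0 ae0).
by exists (prl_ \oc b); rewrite -compA bE compA prl_inl comp1l.
Qed.

Definition tri_morph (A B D A' B' D' : C)
    (x : hom A B) (y : hom B D) (e : E D A)
    (x' : hom A' B') (y' : hom B' D') (e' : E D' A')
    (f : hom A A') (g : hom B B') (h : hom D D') : Prop :=
  [/\ g \oc x = x' \oc f, h \oc y = y' \oc g & push E f e = pull E h e'].

Section Subcategory.
Variable X : subcat C.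

Definition left_approx (A XA : C) (x : hom A XA) : Prop :=
  X XA /\ forall X' : C, X X' -> forall f : hom A X',
    exists u : hom XA X', f = u \oc x.

Definition right_approx (A XA : C) (y : hom XA A) : Prop :=
  X XA /\ forall X' : C, X X' -> forall f : hom X' A,
    exists u : hom X' XA, f = y \oc u.

(* an E-triangle A -> XA -> A^+ with a left X-approximation A -> XA *)
Record left_tri (A : C) := LeftTri {
  lt_mid : C;
  lt_plus : C;
  lt_x : hom A lt_mid;
  lt_y : hom lt_mid lt_plus;
  lt_e : E lt_plus A;
  lt_real : realizes lt_x lt_y lt_e;
  lt_approx : left_approx lt_x }.

(* an E-triangle A^- -> XA -> A with a right X-approximation XA -> A *)
Record right_tri (A : C) := RightTri {
  rt_mid : C;
  rt_minus : C;
  rt_x : hom rt_minus rt_mid;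
  rt_y : hom rt_mid A;
  rt_e : E A rt_minus;
  rt_real : realizes rt_x rt_y rt_e;
  rt_approx : right_approx rt_y }.

Definition strongly_cov_finite : Prop := forall A : C, inhabited (left_tri A).
Definition strongly_contrav_finite : Prop :=
  forall A : C, inhabited (right_tri A).

Definition rigid (n : nat) : Prop :=
  forall i, (1 <= i <= n)%N -> forall X1 X2 : C, X X1 -> X X2 ->
    forall e : Ext i X1 X2, e = 0.

Definition left_perp (i : nat) : set C :=
  [set A : C | forall X' : C, X X' -> forall e : Ext i A X', e = 0]%classic.

Definition right_perp (i : nat) : set C :=
  [set A : C | forall X' : C, X X' -> forall e : Ext i X' A, e = 0]%classic.

Section Suspension.
Variable T : forall A : C, left_tri A.

Definition susp_morph (A B : C) (f : hom A B)
    (g : hom (lt_mid (T A)) (lt_mid (T B)))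
    (h : hom (lt_plus (T A)) (lt_plus (T B))) : Prop :=
  tri_morph (lt_x (T A)) (lt_y (T A)) (lt_e (T A))
            (lt_x (T B)) (lt_y (T B)) (lt_e (T B)) f g h.

Lemma susp_ex (A B : C) (f : hom A B) : exists h, exists g, susp_morph f g h.
Proof.
have [XB _] := lt_approx (T B); have [_ lA] := lt_approx (T A).
have [g gE] := lA _ XB (lt_x (T B) \oc f).
have [h [hE eE]] := @ET3 R C _ _ _ _ _ _ _ _ _ _ _ _ f g
  (lt_real (T A)) (lt_real (T B)) (esym gE).
by exists h, g; split.
Qed.

Lemma susp_wd (A B : C) (f f' : hom A B) g h g' h' :
  susp_morph f g h -> susp_morph f' g' h' -> qpi X f = qpi X f' ->
  qpi X h = qpi X h'.
Proof.
move=> [_ _ ef] [_ _ ef'] /qpiP [M XM [u [v fE]]]; apply/qpiP.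
have [_ lA] := lt_approx (T A); have [XB _] := lt_approx (T B).
have [w uE] := lA _ XM u.
have h0 : pull E (h - h') (lt_e (T B)) = 0.
  rewrite pullBl -ef -ef' -pushBl fE uE !push_comp (real_push0 (lt_real (T A))).
  by rewrite !push0.
have [k ->] := pull0_factor (lt_real (T B)) h0.
by exists (lt_mid (T B)) => //; exists k, (lt_y (T B)).
Qed.

(* [cid] picks one completion of f; by [susp_mapE] the value depends on no choice
   but T.  Likewise for [loop_map]. *)
Definition susp_map (A B : C) (f : qhom X A B) :
    qhom X (lt_plus (T A)) (lt_plus (T B)) :=
  qpi X (projT1 (cid (susp_ex (qrepr f)))).

Lemma susp_mapE (A B : C) (f : hom A B) g h :
  susp_morph f g h -> susp_map (qpi X f) = qpi X h.
Proof.
move=> fgh; rewrite /susp_map; case: cid => h' [g' fgh'] /=.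
by apply: susp_wd fgh' fgh _; rewrite qreprK.
Qed.

Lemma susp_id (A : C) :
  susp_map (qpi X (idc A)) = qpi X (idc (lt_plus (T A))).
Proof.
apply: (@susp_mapE _ _ _ (idc _)).
by split; rewrite ?comp1l ?comp1r ?push_id ?pull_id.
Qed.

Lemma susp_comp (A B D : C) (g : qhom X B D) (f : qhom X A B) :
  susp_map (qcomp g f) = qcomp (susp_map g) (susp_map f).
Proof.
rewrite -(qreprK g) -(qreprK f); move: (qrepr g) (qrepr f) => {}g {}f.
have [h [k fkh]] := susp_ex f; have [h' [k' gkh]] := susp_ex g.
rewrite qcompE (susp_mapE fkh) (susp_mapE gkh) qcompE.
apply: (@susp_mapE _ _ _ (k' \oc k)).
case: fkh gkh => [f1 f2 f3] [g1 g2 g3]; split.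
- by rewrite -compA f1 compA g1 compA.
- by rewrite -compA f2 compA g2 compA.
- by rewrite push_comp f3 push_pull g3 pull_comp.
Qed.

Definition suspension : functor (quot_cat X) (quot_cat X) :=
  @Functor R (quot_cat X) (quot_cat X) (fun A => lt_plus (T A)) susp_map
    susp_id susp_comp.

End Suspension.

Section Loop.
Variable T : forall A : C, right_tri A.

Definition loop_morph (A B : C) (f : hom A B)
    (g : hom (rt_mid (T A)) (rt_mid (T B)))
    (h : hom (rt_minus (T A)) (rt_minus (T B))) : Prop :=
  tri_morph (rt_x (T A)) (rt_y (T A)) (rt_e (T A))
            (rt_x (T B)) (rt_y (T B)) (rt_e (T B)) h g f.

Lemma loop_ex (A B : C) (f : hom A B) : exists h, exists g, loop_morph f g h.
Proof.
have [XA _] := rt_approx (T A); have [_ rB] := rt_approx (T B).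
have [g gE] := rB _ XA (f \oc rt_y (T A)).
have [h [hE eE]] := @ET3op R C _ _ _ _ _ _ _ _ _ _ _ _ g f
  (rt_real (T A)) (rt_real (T B)) gE.
by exists h, g; split.
Qed.

Lemma loop_wd (A B : C) (f f' : hom A B) g h g' h' :
  loop_morph f g h -> loop_morph f' g' h' -> qpi X f = qpi X f' ->
  qpi X h = qpi X h'.
Proof.
move=> [_ _ ef] [_ _ ef'] /qpiP [M XM [u [v fE]]]; apply/qpiP.
have [_ rB] := rt_approx (T B); have [XA _] := rt_approx (T A).
have [w vE] := rB _ XM v.
have h0 : push E (h - h') (rt_e (T A)) = 0.
  rewrite pushBl ef ef' -pullBl fE vE !pull_comp (real_pull0 (rt_real (T B))).
  by rewrite !pull0.
have [k ->] := push0_factor (rt_real (T A)) h0.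
by exists (rt_mid (T A)) => //; exists (rt_x (T A)), k.
Qed.

Definition loop_map (A B : C) (f : qhom X A B) :
    qhom X (rt_minus (T A)) (rt_minus (T B)) :=
  qpi X (projT1 (cid (loop_ex (qrepr f)))).

Lemma loop_mapE (A B : C) (f : hom A B) g h :
  loop_morph f g h -> loop_map (qpi X f) = qpi X h.
Proof.
move=> fgh; rewrite /loop_map; case: cid => h' [g' fgh'] /=.
by apply: loop_wd fgh' fgh _; rewrite qreprK.
Qed.

Lemma loop_id (A : C) :
  loop_map (qpi X (idc A)) = qpi X (idc (rt_minus (T A))).
Proof.
apply: (@loop_mapE _ _ _ (idc _)).
by split; rewrite ?comp1l ?comp1r ?push_id ?pull_id.
Qed.

Lemma loop_comp (A B D : C) (g : qhom X B D) (f : qhom X A B) :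
  loop_map (qcomp g f) = qcomp (loop_map g) (loop_map f).
Proof.
rewrite -(qreprK g) -(qreprK f); move: (qrepr g) (qrepr f) => {}g {}f.
have [h [k fkh]] := loop_ex f; have [h' [k' gkh]] := loop_ex g.
rewrite qcompE (loop_mapE fkh) (loop_mapE gkh) qcompE.
apply: (@loop_mapE _ _ _ (k' \oc k)).
case: fkh gkh => [f1 f2 f3] [g1 g2 g3]; split.
- by rewrite -compA f1 compA g1 compA.
- by rewrite -compA f2 compA g2 compA.
- by rewrite push_comp f3 push_pull g3 pull_comp.
Qed.

Definition loop : functor (quot_cat X) (quot_cat X) :=
  @Functor R (quot_cat X) (quot_cat X) (fun A => rt_minus (T A)) loop_map
    loop_id loop_comp.

End Loop.

End Subcategory.
End ExtriTheory.

Notation "F \cong G" := (nat_iso F G) (at level 70, no associativity).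

(* Main.v *)
From mathcomp Require Import all_boot all_algebra.
From mathcomp Require Import boolp classical_sets.
Require Import Defs.

(** Write A -> XA -> A^+ for the chosen approximation triangles and P for the
    operation A |-> A^+ on objects.

    Powers of the suspension vanish exactly when P^n lands in X
    ([suspension_pow_zeroP]): a functor into C/[X] is zero iff every identity
    of its values factors through X, and an object A whose identity factors
    through X lies in X, because then A -> XA is a split monomorphism and its
    E-triangle exhibits A as a direct summand of XA ([retract_mem]).  It
    remains to compare P^n A with the perpendicular subcategories.

    If the E^i(A, X) vanish for 1 <= i <= k, the approximation property and the
    rigidity of X make the E^i(A^+, X) vanish for 1 <= i <= k + 1; so P^n A always
    lies in the intersection of the left perpendiculars, whence the first
    implication ([iter_plus_mem]).  Conversely let the E^i(X, A) vanish for
    1 <= i <= n.  Dimension shifting along A -> XA -> A^+ gives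
    E^i(X, P^j A) = 0 for 1 <= i <= n - j.  As P^n A is in X, the last
    triangle, with class in E(P^n A, P^(n-1) A) = 0, splits, so P^(n-1) A is in
    X; descending in this way reaches A itself ([right_perp_mem]).

    Both arguments use part of the long exact sequences.  In the covariant
    variable, E^(i+1) is E^i <> E, and every element of the coend is a pure tensor
    x (x) d.  The key point is exactness at E^i(Z, D): for an E-triangle
    A -> B -> D with class d, if x (x) d = 0 then x comes from E^i(Z, B)
    ([tpure_eq0]).  The functor E^i(Z, -) <> E(-, A) is the filtered colimit,
    over all classes d in E(D, A), of the cokernels of E^i(Z, B) -> E^i(Z, D),
    and half-exactness of E^i(Z, -) says that the transition maps to direct
    sums are injective.  Half-exactness then propagates to E^i <> E by the
    octahedral axiom ([tensor_half_exact]).  Exactness at E^(i+1)(Z, A) is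
    a computation with pure tensors ([tensor_push_exact]).

    The contravariant sequences and the whole dual half follow by passing to the
    opposite extriangulated category.  Its higher extensions are again those
    of C, which is not immediate since forming opposites turns E^i <> E into
    E <> E^i; associativity of the tensor product repairs this
    ([opp_bimod_pow]). *)

Set Implicit Arguments.
Unset Strict Implicit.
Unset Printing Implicit Defensive.

Import GRing.Theory.
Local Open Scope ring_scope.

(** * Pure tensors *)

Section PureTensors.
Context {R : comPzRingType} {C : addCat R} (F G : bimod C).

Lemma pushN (D A B : C) (f : hom A B) (e : F D A) :
  push F f (- e) = - push F f e.
Proof. by rewrite -scaleN1r pushZ scaleN1r. Qed.

Lemma tpure0l (A M B : C) (y : G M B) : tpure (0 : F A M) y = 0.
Proof. by rewrite -(scale0r 0) tpureZl scale0r. Qed.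

(** C has direct sums, so x (x) y + x' (x) y' is the tensor over M (+) M' of the
    column (x, x') with the row (y, y'). *)
Lemma tpure_surj (A B : C) (t : tensor F G A B) :
  exists (M : C) (x : F A M) (y : G M B), t = tpure x y.
Proof.
move: t; apply: tensor_ind
  => [M x y||s t [M [x [y ->]]] [M' [x' [y' ->]]]|s|a s].
- by exists M, x, y.
- by exists A, 0, 0; rewrite tpure0l.
- exists (dsum M M'), (push F inl_ x + push F inr_ x'),
    (pull G prl_ y + pull G prr_ y').
  rewrite tpureDl !tpure_balanced !pullD -!pull_comp.
  rewrite prl_inl prr_inl prl_inr prr_inr !pull_id !pull0l.
  by rewrite addr0 add0r.
- by case=> M [x [y ->]]; exists M, (- x), y; rewrite -!scaleN1r tpureZl.
- by case=> M [x [y ->]]; exists M, (a *: x), y; rewrite tpureZl.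
Qed.

End PureTensors.

(** * Covariant exactness of the higher extensions *)

Section Exactness.
Context {R : comPzRingType} {C : extriCat R}.
Notation E := (ext C).

(** If the pushforward of t along x vanishes, then x extends over a realization
    of t; that extension is the middle part of a morphism of triangles with
    identity on A, and its third component is q. *)
Lemma push_exact (A B D N : C) (x : hom A B) (y : hom B D) (e : E D A)
    (t : E N A) :
  realizes x y e -> push E x t = 0 -> exists q : hom N D, t = pull E q e.
Proof.
move=> xye xt0; have [L [l [l' ll't]]] := real_ex t.
have [u ux] := push0_factor ll't xt0.
have [q [_ qE]] := @ET3 R C _ _ _ _ _ _ _ _ _ _ _ _ (idc A) u
  ll't xye ltac:(by rewrite comp1r).
by exists q; rewrite -qE push_id.
Qed.

Definition half_exact (F : bimod C) : Prop :=
  forall (Z A B D : C) (x : hom A B) (y : hom B D) (e : E D A) (t : F Z B),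
    realizes x y e -> push F y t = 0 -> exists s : F Z A, t = push F x s.

(** ** Kernel of the connecting map *)

Section Connecting.
Variables (F : bimod C) (Z A : C).

(** For a realization A -> B -> U of e, this is the exactness statement to be
    proved for a tensor x (x) e that vanishes.  Quantifying over all
    realizations makes closure under sums immediate; one suffices, by
    [lifts_real]. *)
Definition lifts (U : C) (e : E U A) (x : F Z U) : Prop :=
  forall (B : C) (a : hom A B) (y : hom B U),
    realizes a y e -> exists w : F Z B, x = push F y w.

Lemma lifts_real (U B : C) (a : hom A B) (y : hom B U) (e : E U A)
    (w : F Z B) :
  realizes a y e -> lifts e (push F y w).
Proof.
move=> aye B' a' y' a'y'e.
have [b [_ _ <-]] := (real_class a' y' aye).1 a'y'e.
by exists (push F b w); rewrite push_comp.
Qed.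

Lemma lifts0 (U : C) (e : E U A) : lifts e 0.
Proof. by move=> B a y _; exists 0; rewrite push0. Qed.

Lemma liftsD (U : C) (e : E U A) x x' :
  lifts e x -> lifts e x' -> lifts e (x + x').
Proof.
move=> lx lx' B a y aye.
have [w ->] := lx _ _ _ aye; have [w' ->] := lx' _ _ _ aye.
by exists (w + w'); rewrite pushD.
Qed.

Lemma liftsZ (U : C) (e : E U A) k x : lifts e x -> lifts e (k *: x).
Proof.
by move=> lx B a y aye; have [w ->] := lx _ _ _ aye; exists (k *: w); rewrite pushZ.
Qed.

Lemma liftsN (U : C) (e : E U A) x : lifts e x -> lifts e (- x).
Proof. by move=> /(liftsZ (-1)); rewrite scaleN1r. Qed.

Lemma lifts_killed (U M : C) (e : E U A) (c : hom M U) (x : F Z M) :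
  pull E c e = 0 -> lifts e (push F c x).
Proof.
move=> ce0 B a y aye; have [u ->] := pull0_factor aye ce0.
by exists (push F u x); rewrite push_comp.
Qed.

Lemma lifts_diff (U M : C) (e : E U A) (c c' : hom M U) (x : F Z M) :
  pull E c e = pull E c' e -> lifts e (push F c x - push F c' x).
Proof.
by move=> cc'; rewrite -pushBl; apply: lifts_killed; rewrite pullBl cc' subrr.
Qed.

(** Injectivity of the transition maps in the colimit presenting F <> E.
    By the dual octahedral axiom, composing a realization B -> U (+) V of (e, e')
    with the projection to V gives a triangle M -> B -> V, where M -> U
    realizes e.  A lift of (x, 0) to F(Z, B) dies in F(Z, V), so half-exactness
    brings it back to F(Z, M). *)
Lemma lifts_inl (U V : C) (e : E U A) (e' : E V A) (x : F Z U) :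
  half_exact F ->
  lifts (pull E prl_ e + pull E prr_ e') (push F inl_ x) -> lifts e x.
Proof.
move=> exF; set ee := _ + _; move=> lx.
have eeE : pull E inl_ ee = e.
  by rewrite pullD -!pull_comp prl_inl prr_inl pull_id pull0l addr0.
have [B [a [y aye]]] := real_ex ee.
have [w wE] := lx _ _ _ aye.
have [M [d [m [h' [h [e'' [[hE _ h'm] [h'he'' dm _ _]]]]]]]] :=
  ET4op aye (real_zero U V).
have hw0 : push F h w = 0.
  by rewrite hE push_comp -wE -push_comp prr_inl push0l.
have [v vE] := exF _ _ _ _ _ _ _ _ h'he'' hw0.
suff -> : x = push F m v by apply: lifts_real; rewrite -eeE; exact: dm.
rewrite -[x]push_id -(@prl_inl R C U V) push_comp wE vE -(push_comp y) h'm.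
by rewrite -!push_comp compA prl_inl comp1l.
Qed.

Lemma liftsBD (U : C) (e : E U A) x x' y y' :
  lifts e (x - y) -> lifts e (x' - y') -> lifts e (x + x' - (y + y')).
Proof. by move=> l l'; rewrite opprD addrACA; apply: liftsD. Qed.

Lemma liftsBZ (U : C) (e : E U A) k x y :
  lifts e (x - y) -> lifts e (k *: x - k *: y).
Proof. by rewrite -scalerBr; apply: liftsZ. Qed.

Lemma liftsBN (U : C) (e : E U A) x y :
  lifts e (x - y) -> lifts e (- x - - y).
Proof. by rewrite -opprD; apply: liftsN. Qed.

(** All the extensions occurring in a formal term are pulled back from a single
    class e in E(U, A); balancing then rewrites the term as x (x) e with x in
    F(Z, U), and this x is what is recorded.  Such an x is determined by the
    term and e only up to [lifts]. *)
Fixpoint represents (U : C) (e : E U A) (t : tterm F E Z A) (x : F Z U) : Prop :=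
  match t with
  | TGen M x0 d => exists2 c : hom M U, pull E c e = d & x = push F c x0
  | TZero => x = 0
  | TAdd s t => exists x1 x2,
      [/\ represents e s x1, represents e t x2 & x = x1 + x2]
  | TOpp t => exists2 x1, represents e t x1 & x = - x1
  | TScale a t => exists2 x1, represents e t x1 & x = a *: x1
  end.

Lemma represents_push (U V : C) (e : E V A) (c : hom U V) t (x : F Z U) :
  represents (pull E c e) t x -> represents e t (push F c x).
Proof.
elim: t x => [M x0 d||s Hs t Ht|t Ht|a t Ht] /= x.
- by case=> b bE ->; exists (c \oc b); rewrite ?pull_comp ?push_comp.
- by move=> ->; rewrite push0.
- case=> x1 [x2 [/Hs s1 /Ht t2 ->]].
  by exists (push F c x1), (push F c x2); rewrite pushD.
- by case=> x1 /Ht ? ->; exists (push F c x1); rewrite ?pushN.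
- by case=> x1 /Ht ? ->; exists (push F c x1); rewrite ?pushZ.
Qed.

Lemma represents_common (U V : C) (e : E U A) (e' : E V A) s t x y :
  represents e s x -> represents e' t y ->
  let ee := pull E prl_ e + pull E prr_ e' : E (dsum U V) A in
  represents ee s (push F inl_ x) /\ represents ee t (push F inr_ y).
Proof.
move=> sx ty ee; split; apply: represents_push; rewrite pullD -!pull_comp.
  by rewrite prl_inl prr_inl pull_id pull0l addr0.
by rewrite prl_inr prr_inr pull_id pull0l add0r.
Qed.

(** A common class for the two summands of a sum is their joint class over the
    direct sum. *)
Lemma represents_ex (t : tterm F E Z A) :
  exists (U : C) (e : E U A) (x : F Z U), represents e t x.
Proof.
elim: t => [M x d||s [U [e [x sx]]] t [V [e' [y ty]]]|t|a t] /=.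
- by exists M, d, x, (idc M); rewrite ?pull_id ?push_id.
- by exists A, 0, 0.
- have [sx' ty'] := represents_common sx ty.
  do 2!eexists; exists (push F inl_ x + push F inr_ y).
  by do 2!eexists; split; [exact: sx' | exact: ty' |].
- by case=> U [e [x tx]]; exists U, e, (- x), x.
- by case=> U [e [x tx]]; exists U, e, (a *: x), x.
Qed.

Lemma represents_uniq (U : C) (e : E U A) t x x' :
  represents e t x -> represents e t x' -> lifts e (x - x').
Proof.
elim: t x x' => [M x0 d||s Hs t Ht|t Ht|a t Ht] /= x x'.
- by move=> [c cE ->] [c' c'E ->]; apply: lifts_diff; rewrite cE.
- by move=> -> ->; rewrite subrr; apply: lifts0.
- by move=> [? [? [? ? ->]]] [? [? [? ? ->]]]; apply: liftsBD; [apply: Hs | apply: Ht].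
- by move=> [? ? ->] [? ? ->]; apply/liftsBN/Ht.
- by move=> [? ? ->] [? ? ->]; apply/liftsBZ/Ht.
Qed.

(** Invariance under the relations of the coend, by induction on a derivation
    of the relation.  For each generating relation, both sides are written
    over e, and the discrepancy is the image of an element of F under a
    morphism that kills e. *)
Lemma represents_eqv (exF : half_exact F) s t :
  teqv s t -> forall (U : C) (e : E U A) x y,
  represents e s x -> represents e t y -> lifts e (x - y).
Proof.
have uniq := represents_uniq.
elim=> {s t}.
- by move=> t U e x y; apply: uniq.
- by move=> s t _ H U e x y sx ty; rewrite -opprB; apply/liftsN/H.
- move=> t s u _ Hst _ Htu U e x z sx uz.
  (* In a chain s ~ t ~ u the middle term may involve extensions that are not
     pulled back from e; it is represented over another class e', and the
     comparison over (e, e') descends to e. *)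
  have [V [e' [y ty]]] := represents_ex t.
  apply: (lifts_inl (e' := e') exF); rewrite pushD pushN.
  have [sx' ty'] := represents_common sx ty.
  have [uz' _] := represents_common uz ty.
  by have := liftsD (Hst _ _ _ _ sx' ty') (Htu _ _ _ _ ty' uz'); rewrite addrA subrK.
- move=> s s' t t' _ Hs _ Ht U e _ _ [? [? [? ? ->]]] [? [? [? ? ->]]].
  by apply: liftsBD; [apply: Hs | apply: Ht].
- by move=> t t' _ Ht U e _ _ [? ? ->] [? ? ->]; apply/liftsBN/Ht.
- by move=> a t t' _ Ht U e _ _ [? ? ->] [? ? ->]; apply/liftsBZ/Ht.
- move=> s t u U e _ _ [x1 [z [s1 [x2 [x3 [t2 u3 ->]]] ->]]]
    [z' [y3 [[y1 [y2 [s1' t2' ->]]] u3' ->]]].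
  rewrite addrA; do 2?apply: liftsBD; [exact: uniq s1 s1'|exact: uniq t2 t2'|].
  exact: uniq u3 u3'.
- move=> s t U e _ _ [x1 [x2 [s1 t2 ->]]] [y1 [y2 [t1 s2 ->]]].
  by rewrite [x1 + x2]addrC; apply: liftsBD; [apply: uniq t2 t1 | apply: uniq s1 s2].
- move=> t U e _ y [? [x [-> tx ->]]] ty; rewrite add0r; exact: uniq tx ty.
- move=> t U e _ _ [? [x [[x' tx' ->] tx ->]]] ->.
  by rewrite subr0 addrC; apply: uniq tx tx'.
- move=> a b t U e _ _ [_ [x tx ->] ->] [y ty ->].
  by rewrite scalerA; apply/liftsBZ/(uniq _ _ _ _ _ tx ty).
- move=> t U e _ y [x tx ->] ty; rewrite scale1r; exact: uniq tx ty.
- move=> a s t U e _ _ [? [x [x' [sx tx' ->]]] ->]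
    [? [? [[y sy ->] [y' ty' ->] ->]]]; rewrite scalerDr.
  by apply: liftsBD; apply: liftsBZ; [apply: uniq sx sy | apply: uniq tx' ty'].
- move=> t a b U e _ _ [x tx ->] [? [? [[y ty ->] [y' ty' ->] ->]]].
  by rewrite scalerDl; apply: liftsBD; apply: liftsBZ; apply: uniq tx _.
- move=> M x x' d U e _ _ [c cE ->] [? [? [[c1 c1E ->] [c2 c2E ->] ->]]].
  by rewrite pushD; apply: liftsBD; apply: lifts_diff; rewrite cE.
- move=> M x d d' U e _ _ [c cE ->] [? [? [[c1 c1E ->] [c2 c2E ->] ->]]].
  by rewrite -pushDl; apply: lifts_diff; rewrite pullDl cE c1E c2E.
- move=> M a x d U e _ _ [c cE ->] [_ [c1 c1E ->] ->].
  by rewrite pushZ; apply/liftsBZ/lifts_diff; rewrite cE.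
- move=> M a x d U e _ _ [c cE ->] [_ [c1 c1E ->] ->].
  by rewrite -pushZl; apply: lifts_diff; rewrite pullZl cE c1E.
- move=> M M' f x d U e _ _ [c cE ->] [c1 c1E ->].
  by rewrite -push_comp; apply: lifts_diff; rewrite pull_comp cE c1E.
Qed.

End Connecting.

(** Over e itself the term x (x) e is represented by x, and zero by 0. *)
Lemma tpure_eq0 (F : bimod C) (Z A D : C) (e : E D A) (x : F Z D) :
  half_exact F -> tpure x e = 0 -> lifts e x.
Proof.
move=> exF /(@pm_clsP _ (tensor_premod F E Z A)) xe0; rewrite -[x]subr0.
apply: (represents_eqv exF xe0) => //=.
by exists (idc D); rewrite ?pull_id ?push_id.
Qed.

(** ** Half-exactness *)

(** The octahedral axiom applied to A -> B -> D and to a realization B -> L -> Z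
    of t yields a realization D -> M -> Z of the pushforward of t, which splits,
    and a class in E(M, A) whose image in E(M, B) is the pullback of t; pulling
    that class back along the splitting Z -> M gives the preimage of t. *)
Lemma ext_half_exact : half_exact E.
Proof.
move=> Z A B D f g e t fge gt0.
have [L [l [m lmt]]] := real_ex t.
have [M [h [h' [d [m' [e'' [[_ _ m'h'] [_ dm' _ fe'']]]]]]]] := ET4 fge lmt.
have [k idE] := pull0_factor (c := idc Z) dm' ltac:(by rewrite pull_id gt0).
by exists (pull E k e''); rewrite push_pull fe'' -pull_comp -idE pull_id.
Qed.

(** The argument of [ext_half_exact] with the splitting replaced by the lift
    of x to F(Z, M) that [tpure_eq0] provides. *)
Lemma tensor_half_exact (F : bimod C) :
  half_exact F -> half_exact (tensor F E).
Proof.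
move=> exF Z A B D f g e t fge.
have [Y [x [y ->]]] := tpure_surj t; rewrite [push _ _ _]tpushE => xgy0.
have [L [l [m lmy]]] := real_ex y.
have [M [h [h' [d [m' [e'' [_ [_ dm' _ fe'']]]]]]]] := ET4 fge lmy.
have [w ->] := tpure_eq0 exF xgy0 dm'.
exists (tpure w e''); rewrite tpure_balanced -fe''; symmetry; exact: tpushE.
Qed.

Lemma Ext_half_exact i : half_exact (Ext i.+1).
Proof.
by elim: i => [|i IH]; [exact: ext_half_exact | exact: tensor_half_exact].
Qed.

(** For t = u (x) v, the vanishing of u (x) x_* v lifts u along a realization p of
    x_* v; hence t = w (x) p^* v, and p^* v is killed by x, so that it
    is a pullback of e. *)
Lemma tensor_push_exact (F : bimod C) (Z A B D : C) (x : hom A B)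
    (y : hom B D) (e : E D A) (t : tensor F E Z A) :
  half_exact F -> realizes x y e -> push (tensor F E) x t = 0 ->
  exists s : F Z D, t = tpure s e.
Proof.
move=> exF xye; have [Y [u [v ->]]] := tpure_surj t.
rewrite [push _ _ _]tpushE => uv0.
have [N [a [p apv]]] := real_ex (push E x v).
have [w ->] := tpure_eq0 exF uv0 apv.
have [q qE] := push_exact (t := pull E p v) xye
  ltac:(by rewrite push_pull (real_pull0 apv)).
by exists (push F q w); rewrite !tpure_balanced qE.
Qed.

End Exactness.

(** * Isomorphisms of bimodules and associativity of the tensor product *)

Section BimodIsomorphisms.
Context {R : comPzRingType} {C : addCat R}.

Record bimod_mor (F G : bimod C) := BimodMor {
  bmor :> forall D A : C, F D A -> G D A;
  bmorD : forall D A (s t : F D A), bmor (s + t) = bmor s + bmor t;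
  bmorZ : forall D A a (t : F D A), bmor (a *: t) = a *: bmor t;
  bmor_push : forall D A B (f : hom A B) (t : F D A),
    bmor (push F f t) = push G f (bmor t);
  bmor_pull : forall D' D A (g : hom D' D) (t : F D A),
    bmor (pull F g t) = pull G g (bmor t) }.

Definition bimod_iso (F G : bimod C) : Prop :=
  exists (f : bimod_mor F G) (g : bimod_mor G F), forall D A,
    cancel (@f D A) (@g D A) /\ cancel (@g D A) (@f D A).

Lemma bimod_iso_refl F : bimod_iso F F.
Proof.
pose f := @BimodMor F F (fun _ _ => id) (fun _ _ _ _ => erefl)
  (fun _ _ _ _ => erefl) (fun _ _ _ _ _ => erefl) (fun _ _ _ _ _ => erefl).
by exists f, f.
Qed.

Lemma bimod_iso_sym F G : bimod_iso F G -> bimod_iso G F.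
Proof. by case=> f [g fg]; exists g, f => D A; have [] := fg D A. Qed.

Lemma bimod_iso_trans G F H : bimod_iso F G -> bimod_iso G H -> bimod_iso F H.
Proof.
have comp_ex F1 F2 F3 (g : bimod_mor F2 F3) (f : bimod_mor F1 F2) :
    exists h : bimod_mor F1 F3, forall D A t, @h D A t = g D A (f D A t).
  unshelve eexists (@BimodMor F1 F3 (fun D A t => g D A (f D A t)) _ _ _ _) => //.
  - by move=> * /=; rewrite !bmorD.
  - by move=> * /=; rewrite !bmorZ.
  - by move=> * /=; rewrite !bmor_push.
  - by move=> * /=; rewrite !bmor_pull.
move=> [f [f' fK]] [g [g' gK]].
have [h hE] := comp_ex _ _ _ g f; have [h' h'E] := comp_ex _ _ _ f' g'.
exists h, h' => D A; have [ff' f'f] := fK D A; have [gg' g'g] := gK D A.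
by split=> t; rewrite hE h'E ?gg' ?ff' ?f'f ?g'g.
Qed.

Lemma bimod_iso_vanish F G (D A : C) :
  bimod_iso F G -> (forall t : F D A, t = 0) -> forall t : G D A, t = 0.
Proof.
move=> [f [g fg]] F0 t; have [_ gK] := fg D A.
by rewrite -(gK t) (F0 (g D A t)) -(scale0r 0) bmorZ scale0r.
Qed.

(** The universal property of the coend, for families natural in both outer
    variables. *)
Lemma tensor_mor (F G H : bimod C)
    (phi : forall D A M, F D M -> G M A -> H D A) :
  (forall D A, balanced (@phi D A)) ->
  (forall D A B M (f : hom A B) (x : F D M) (y : G M A),
     phi D B M x (push G f y) = push H f (phi D A M x y)) ->
  (forall D' D A M (g : hom D' D) (x : F D M) (y : G M A),
     phi D' A M (pull F g x) y = pull H g (phi D A M x y)) ->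
  exists f : bimod_mor (tensor F G) H,
    forall D A M (x : F D M) (y : G M A), f D A (tpure x y) = phi D A M x y.
Proof.
move=> bal phi_push phi_pull.
unshelve eexists
  (@BimodMor (tensor F G) H (fun D A => tlift (@phi D A)) _ _ _ _).
- by move=> D A; apply: tliftD.
- by move=> D A; apply: tliftZ.
- move=> D A B f t; have [M [x [y ->]]] := tpure_surj t.
  by rewrite [push _ _ _]tpushE !tlift_pure.
- move=> D' D A g t; have [M [x [y ->]]] := tpure_surj t.
  by rewrite [pull _ _ _]tpullE !tlift_pure.
- by move=> D A M x y; apply: tlift_pure.
Qed.

Lemma tensor_isol (F F' G : bimod C) :
  bimod_iso F F' -> bimod_iso (tensor F G) (tensor F' G).
Proof.
have mor (H H' : bimod C) (f : bimod_mor H H') :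
    exists h : bimod_mor (tensor H G) (tensor H' G), forall D A M x (y : G M A),
      h D A (tpure x y) = tpure (f D M x) y.
  apply: (@tensor_mor H G (tensor H' G) (fun D A M x y => tpure (f D M x) y)).
  - by split=> *; rewrite ?bmorD ?bmorZ ?bmor_push
      ?(tpureDl, tpureDr, tpureZl, tpureZr, tpure_balanced).
  - by move=> *; rewrite [RHS]tpushE.
  - by move=> *; rewrite bmor_pull [RHS]tpullE.
move=> [f [g fg]]; have [h hE] := mor _ _ f; have [k kE] := mor _ _ g.
exists h, k => D A; split=> t; have [M [x [y ->]]] := tpure_surj t;
  by rewrite hE kE || rewrite kE hE; have [fK gK] := fg D M; rewrite ?fK ?gK.
Qed.

Lemma tensorA_iso (F G H : bimod C) :
  bimod_iso (tensor (tensor F G) H) (tensor F (tensor G H)).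
Proof.
have assocl_bal D A M (z : H M A) :
    balanced (fun N (x : F D N) (y : G N M) =>
      (tpure x (tpure y z : tensor G H N A) : tensor F (tensor G H) D A)).
  split=> *; rewrite ?(tpureDl, tpureDr, tpureZl, tpureZr) //.
  rewrite tpure_balanced; congr (tpure _ _); exact: tpullE.
have assocr_bal D A M (x : F D M) :
    balanced (fun N (y : G M N) (z : H N A) =>
      (tpure (tpure x y : tensor F G D N) z : tensor (tensor F G) H D A)).
  split=> *; rewrite ?(tpureDl, tpureDr, tpureZl, tpureZr) //.
  rewrite -tpure_balanced; congr (tpure _ _); symmetry; exact: tpushE.
have [l lE] : exists l : bimod_mor (tensor (tensor F G) H) (tensor F (tensor G H)),
    forall D A M N (x : F D N) (y : G N M) (z : H M A),
      l D A (tpure (tpure x y : tensor F G D M) z)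
      = tpure x (tpure y z : tensor G H N A).
  have [] := @tensor_mor (tensor F G) H (tensor F (tensor G H))
    (fun D A M t z => tlift (fun N (x : F D N) (y : G N M) =>
       (tpure x (tpure y z : tensor G H N A) : tensor F (tensor G H) D A)) t).
  - move=> D A; split.
    + by move=> M s t z; apply: tliftD.
    + move=> M t z z'; have [N [x [y ->]]] := tpure_surj t.
      by rewrite !tlift_pure // !tpureDr.
    + by move=> M a t z; apply: tliftZ.
    + move=> M a t z; have [N [x [y ->]]] := tpure_surj t.
      by rewrite !tlift_pure // !tpureZr.
    + move=> M M' f t z; have [N [x [y ->]]] := tpure_surj t.
      by rewrite [push _ _ _]tpushE !tlift_pure // tpure_balanced.
  - move=> D A B M f t z; have [N [x [y ->]]] := tpure_surj t.
    rewrite !tlift_pure // [RHS]tpushE; congr (tpure _ _); symmetry; exact: tpushE.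
  - move=> D' D A M g t z; have [N [x [y ->]]] := tpure_surj t.
    by rewrite [pull _ _ _]tpullE !tlift_pure // [RHS]tpullE.
  by move=> l lE; exists l => *; rewrite lE tlift_pure.
have [r rE] : exists r : bimod_mor (tensor F (tensor G H)) (tensor (tensor F G) H),
    forall D A M N (x : F D N) (y : G N M) (z : H M A),
      r D A (tpure x (tpure y z : tensor G H N A))
      = tpure (tpure x y : tensor F G D M) z.
  have [] := @tensor_mor F (tensor G H) (tensor (tensor F G) H)
    (fun D A M x t => tlift (fun N (y : G M N) (z : H N A) =>
       (tpure (tpure x y : tensor F G D N) z : tensor (tensor F G) H D A)) t).
  - move=> D A; split.
    + move=> M x x' t; have [N [y [z ->]]] := tpure_surj t.
      by rewrite !tlift_pure // !tpureDl.
    + by move=> M x s t; apply: tliftD.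
    + move=> M a x t; have [N [y [z ->]]] := tpure_surj t.
      by rewrite !tlift_pure // !tpureZl.
    + by move=> M a x t; apply: tliftZ.
    + move=> M M' f x t; have [N [y [z ->]]] := tpure_surj t.
      by rewrite [pull _ _ _]tpullE !tlift_pure // tpure_balanced.
  - move=> D A B M f x t; have [N [y [z ->]]] := tpure_surj t.
    by rewrite [push _ _ _]tpushE !tlift_pure // [RHS]tpushE.
  - move=> D' D A M g x t; have [N [y [z ->]]] := tpure_surj t.
    rewrite !tlift_pure // [RHS]tpullE; congr (tpure _ _); symmetry; exact: tpullE.
  by move=> r rE; exists r => *; rewrite rE tlift_pure.
exists l, r => D A; split=> t.
  have [M [s [z ->]]] := tpure_surj t; have [N [x [y ->]]] := tpure_surj s.
  by rewrite lE rE.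
have [N [x [s ->]]] := tpure_surj t; have [M [y [z ->]]] := tpure_surj s.
by rewrite rE lE.
Qed.

(** Induction on i: the extra factor on the left is moved inside the bracket by
    associativity. *)
Lemma bimod_powSl (F : bimod C) i :
  bimod_iso (tensor F (bimod_pow F i.+1)) (bimod_pow F i.+2).
Proof.
elim: i => [|i IH]; first exact: bimod_iso_refl.
apply: bimod_iso_trans (bimod_iso_sym (tensorA_iso F (bimod_pow F i.+1) F)) _.
exact: (tensor_isol F IH).
Qed.

End BimodIsomorphisms.

(** * The opposite extriangulated category *)

Section Opposite.
Context {R : comPzRingType}.

Definition opp_cat (C : addCat R) : addCat R.
Proof.
refine (@AddCat R C (fun A B => hom B A) (@idc R C)
  (fun A B D g f => f \oc g) _ _ _ _ _ _ _ (zobj C) _ _ (@dsum R C)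
  (fun A B => prl_) (fun A B => prr_) (fun A B => inl_) (fun A B => inr_)
  _ _ _ _ _) => *.
- by rewrite compA.
- exact: comp1r.
- exact: comp1l.
- exact: compDr.
- exact: compDl.
- exact: compZr.
- exact: compZl.
- exact: zobj_term.
- exact: zobj_init.
- exact: prl_inl.
- exact: prr_inr.
- exact: prl_inr.
- exact: prr_inl.
- exact: dsum_id.
Defined.

Definition opp_bimod (C : addCat R) (F : bimod C) : bimod (opp_cat C).
Proof.
refine (@Bimod R (opp_cat C) (fun D A => F A D)
  (fun D A B f e => pull F f e) (fun D' D A g e => push F g e)
  _ _ _ _ _ _ _ _ _ _ _ _ _) => *.
- exact: pull_id.
- exact: pull_comp.
- exact: push_id.
- exact: push_comp.
- by rewrite push_pull.
- exact: pullD.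
- exact: pullZ.
- exact: pushD.
- exact: pushZ.
- exact: pullDl.
- exact: pullZl.
- exact: pushDl.
- exact: pushZl.
Defined.

Lemma opp_bimod_iso (C : addCat R) (F G : bimod C) :
  bimod_iso F G -> bimod_iso (opp_bimod F) (opp_bimod G).
Proof.
have mor (H H' : bimod C) (f : bimod_mor H H') :
    exists h : bimod_mor (opp_bimod H) (opp_bimod H'),
      forall D A t, h D A t = f A D t.
  unshelve eexists (@BimodMor R (opp_cat C) (opp_bimod H) (opp_bimod H')
    (fun D A => @f A D) _ _ _ _) => //.
  - by move=> D A; exact: (@bmorD R C H H' f A D).
  - by move=> D A; exact: (@bmorZ R C H H' f A D).
  - by move=> D A B; exact: (@bmor_pull R C H H' f B A D).
  - by move=> D' D A; exact: (@bmor_push R C H H' f A D D').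
move=> [f [g fg]]; have [h hE] := mor _ _ f; have [k kE] := mor _ _ g.
by exists h, k => D A; have [fK gK] := fg A D; split=> t; rewrite ?kE ?hE ?kE ?fK ?gK.
Qed.

Lemma opp_tensor_iso (C : addCat R) (F G : bimod C) :
  bimod_iso (tensor (opp_bimod F) (opp_bimod G)) (opp_bimod (tensor G F)).
Proof.
have [f fE] : exists f : bimod_mor (tensor (opp_bimod F) (opp_bimod G))
                                   (opp_bimod (tensor G F)),
    forall D A M (x : opp_bimod F D M) (y : opp_bimod G M A),
      f D A (tpure x y) = tpure (y : G A M) (x : F M D).
  apply: (@tensor_mor R (opp_cat C) (opp_bimod F) (opp_bimod G)
    (opp_bimod (tensor G F)) (fun D A M x y => tpure (y : G A M) (x : F M D))).
  - move=> D A; split=> *; rewrite ?(tpureDl, tpureDr, tpureZl, tpureZr) //.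
    by rewrite /= tpure_balanced.
  - by move=> *; symmetry; apply: tpullE.
  - by move=> *; symmetry; apply: tpushE.
have bal D A : @balanced R C G F A D (tensor (opp_bimod F) (opp_bimod G) D A)
    (fun M y x => @tpure R (opp_cat C) (opp_bimod F) (opp_bimod G) D A M x y).
  split=> *; rewrite ?(tpureDl, tpureDr, tpureZl, tpureZr) //.
  symmetry; exact: (@tpure_balanced R (opp_cat C) (opp_bimod F) (opp_bimod G)).
pose gf D A : opp_bimod (tensor G F) D A -> tensor (opp_bimod F) (opp_bimod G) D A
  := @tlift R C G F A D _
       (fun M y x => @tpure R (opp_cat C) (opp_bimod F) (opp_bimod G) D A M x y).
have gE D A M (y : G A M) (x : F M D) :
    gf D A (tpure y x) = @tpure R (opp_cat C) (opp_bimod F) (opp_bimod G) D A M x y.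
  exact: tlift_pure.
unshelve epose (g := @BimodMor R (opp_cat C) (opp_bimod (tensor G F))
  (tensor (opp_bimod F) (opp_bimod G)) gf _ _ _ _).
- by move=> D A; apply: tliftD.
- by move=> D A; apply: tliftZ.
- move=> D A B h t; have [M [y [x ->]]] := @tpure_surj R C G F _ _ t.
  rewrite gE [RHS]tpushE /=; etransitivity; last exact: gE.
  congr (gf _ _ _); exact: tpullE.
- move=> D' D A h t; have [M [y [x ->]]] := @tpure_surj R C G F _ _ t.
  rewrite gE [RHS]tpullE /=; etransitivity; last exact: gE.
  congr (gf _ _ _); exact: tpushE.
exists f, g => D A; split=> t.
  have [M [x [y ->]]] := tpure_surj t; rewrite fE; exact: gE.
have [M [y [x ->]]] := @tpure_surj R C G F _ _ t.
rewrite [g _ _ _]gE; exact: fE.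
Qed.

(** Passing to opposites turns F^i <> F into F <> F^i, which is F^(i+1) by
    [bimod_powSl]. *)
Lemma opp_bimod_pow (C : addCat R) (F : bimod C) i :
  bimod_iso (bimod_pow (opp_bimod F) i.+1) (opp_bimod (bimod_pow F i.+1)).
Proof.
elim: i => [|i IH]; first exact: bimod_iso_refl.
apply: bimod_iso_trans (tensor_isol (opp_bimod F) IH) _.
apply: bimod_iso_trans (opp_tensor_iso _ _) _.
exact: opp_bimod_iso (bimod_powSl F i).
Qed.

(** The two composites differ only by their bracketing. *)
Lemma opp_dsum_map (C : addCat R) (A A' B B' : C) (f : hom A B)
    (f' : hom A' B') :
  @dsum_map R (opp_cat C) B B' A A' f f' = dsum_map f f'.
Proof. by rewrite /dsum_map /= !compA. Qed.

Definition opp_extri (C : extriCat R) : extriCat R.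
Proof.
refine (@ExtriCat R (opp_cat C) (opp_bimod (ext C))
  (fun A B D x y e => @realizes R C D B A y x e) _ _ _ _ _ _ _ _ _).
- by move=> A D e; have [B [x [y xye]]] := real_ex e; exists B, y, x.
- move=> A B B' D e x y x' y' xye; split.
    move=> /(real_class y' x' xye) [b [[c [cb bc]] by' yb]].
    exists c; split; [by exists b; split | by rewrite /= -yb -compA bc comp1r |].
    by rewrite /= -by' compA cb comp1l.
  move=> [c [[b [bc cb]] xc cy]]; apply/(real_class y' x' xye).
  exists b; split; [by exists c | |].
    by rewrite -cy /= compA; rewrite /= in cb; rewrite cb comp1l.
  by rewrite -xc /= -compA; rewrite /= in bc; rewrite bc comp1r.
- move=> A B D A' B' D' e e' x y x' y' a c xye xye' ae.
  have [b [bE b'E]] := @real_map R C _ _ _ _ _ _ _ _ _ _ _ _ c a xye' xye (esym ae).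
  by exists b.
(* The split triangle D -> A (+) D -> A differs from the given
   D -> D (+) A -> A by the swap of the summands. *)
- move=> A D; apply/(real_class _ _ (real_zero D A)).
  exists (inl_ \oc prr_ + inr_ \oc prl_); split.
  + exists (inl_ \oc prr_ + inr_ \oc prl_); split;
    rewrite /= compDl !compDr -!compA !(compA prl_) !(compA prr_) prl_inl prl_inr
      prr_inl prr_inr !comp1l !comp0l !comp0r addr0 add0r; exact: dsum_id.
  + by rewrite /= compDl -!compA (@prr_inl R C) (@prl_inl R C) comp0r add0r comp1r.
  + change (@prl_ R C A D \oc (inl_ \oc prr_ + inr_ \oc prl_) = @prr_ R C D A).
    by rewrite compDr !compA prl_inl prl_inr comp1l comp0l addr0.
- move=> A B D A' B' D' e e' x y x' y' xye xye'.
  rewrite (@opp_dsum_map C D D' B B' y y') (@opp_dsum_map C B B' A A' x x').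
  rewrite /= -!push_pull.
  exact: (real_dsum xye xye').
- move=> A B D A' B' D' e e' x y x' y' a b xye xye' bx.
  have [c [cE c'E]] := @ET3op R C _ _ _ _ _ _ _ _ _ _ _ _ b a xye' xye (esym bx).
  by exists c.
- move=> A B D A' B' D' e e' x y x' y' b c xye xye' cy.
  have [a [aE a'E]] := @ET3 R C _ _ _ _ _ _ _ _ _ _ _ _ c b xye' xye (esym cy).
  by exists a.
- move=> A B D G F e e' f f' g g' ffe gge.
  have [M [d [m [h' [h [e'' [[E1 E2 E3] [E4 E5 E6 E7]]]]]]]] := ET4op gge ffe.
  by exists M, h, h', m, d, e''; split; split=> //=.
- move=> D A B F G e e' f' f g' g ffe gge.
  have [M [h [h' [d [m [e'' [[E1 E2 E3] [E4 E5 E6 E7]]]]]]]] := ET4 gge ffe.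
  by exists M, m, d, h', h, e''; split; split=> //=.
Defined.

End Opposite.

(** * Approximation triangles and perpendicular subcategories *)

Section Approximations.
Context {R : comPzRingType} {C : extriCat R}.
Variable X : subcat C.
Notation E := (ext C).

Lemma split_mem (A B D : C) (x : hom A B) (y : hom B D) (e : E D A) :
  realizes x y e -> e = 0 -> X B -> X A.
Proof.
move=> xye e0 XB; apply: (@sub_summand _ _ X A D).
have [b [bI _ _]] := (real_class inl_ prr_ xye).1 ltac:(rewrite e0; exact: real_zero).
by apply: sub_iso XB; exists b.
Qed.

(** Idempotents of C need not split, so that a retract of an object of X is not a
    summand for free.  But a factorization of the identity through X passes
    through the approximation A -> XA; this is therefore a split
    monomorphism, and its class vanishes, being killed by it. *)
Lemma retract_mem (A : C) : left_tri X A -> factors X (idc A) -> X A.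
Proof.
move=> T [M XM [g [h hg]]]; have [XXA lA] := lt_approx T.
have [u gE] := lA _ XM g.
apply: (split_mem (lt_real T)) XXA.
by rewrite -[LHS]push_id hg gE !push_comp (real_push0 (lt_real T)) !push0.
Qed.

(** One dimension shift along A^- -> XA -> A.  For i = 0 the approximation
    property takes the place of the perpendicularity of A: every morphism from X
    to A factors through XA and therefore kills the class of the triangle. *)
Lemma right_perp_minus (A : C) (T : right_tri X A) i :
  (forall X1 X2 : C, X X1 -> X X2 -> forall e : Ext i.+1 X1 X2, e = 0) ->
  ((0 < i)%N -> right_perp X i A) -> right_perp X i.+1 (rt_minus T).
Proof.
have [XXA rA] := rt_approx T.
case: i => [|i] rig perp Y XY e; have xe0 := rig _ _ XY XXA (push _ (rt_x T) e).
  have [q ->] := push_exact (rt_real T) xe0.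
  have [u ->] := rA _ XY q.
  by rewrite pull_comp (real_pull0 (rt_real T)) pull0.
have [s ->] := tensor_push_exact (@Ext_half_exact _ C i) (rt_real T) xe0.
by rewrite (perp isT Y XY s) tpure0l.
Qed.

(** For e in E^(i+1)(Y, A^+), the product with the class of A -> XA -> A^+ lies
    in E^(i+2)(Y, A) = 0, so e comes from E^(i+1)(Y, XA), which vanishes
    by rigidity. *)
Lemma right_perp_plus (A : C) (T : left_tri X A) i :
  (forall X1 X2 : C, X X1 -> X X2 -> forall e : Ext i.+1 X1 X2, e = 0) ->
  right_perp X i.+2 A -> right_perp X i.+1 (lt_plus T).
Proof.
move=> rig perp Y XY e.
have [XXA _] := lt_approx T.
have [w ->] := tpure_eq0 (@Ext_half_exact _ C i) (perp Y XY (tpure e (lt_e T)))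
                 (lt_real T).
by rewrite (rig _ _ XY XXA w) push0.
Qed.

(** Each application of A |-> A^- gains one degree of perpendicularity, starting
    from none. *)
Lemma iter_minus_mem n (T : forall A : C, right_tri X A) :
  rigid X n ->
  smem X = (\bigcap_(i in [set i | (1 <= i <= n)%N]) right_perp X i)%classic ->
  forall A, X (iter n (fun A => rt_minus (T A)) A).
Proof.
move=> rig XE A.
have perp k i : (k <= n)%N -> (1 <= i <= k)%N ->
    right_perp X i (iter k (fun A => rt_minus (T A)) A).
  elim: k i => [|k IH] [|i] //= kn ik.
  apply: right_perp_minus => [|i0]; first by apply: rig; apply: leq_trans ik kn.
  by apply: IH; [exact: ltnW | rewrite i0].
by rewrite XE => i /= ik; apply: perp.
Qed.

(** Each application of A |-> A^+ loses one degree of perpendicularity.  Of the n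
    available ones, E^1(X, -) = 0 is still left at the object before the last,
    which makes the triangles split one after the other from the end. *)
Lemma right_perp_mem n (T : forall A : C, left_tri X A) :
  rigid X n -> (forall A, X (iter n (fun A => lt_plus (T A)) A)) ->
  smem X = (\bigcap_(i in [set i | (1 <= i <= n)%N]) right_perp X i)%classic.
Proof.
move=> rig Xn; apply/seteqP; split=> A XA; first by move=> i ik Y XY; apply: rig.
have perp j i : (0 < i)%N -> (i + j <= n)%N ->
    right_perp X i (iter j (fun A => lt_plus (T A)) A).
  elim: j i => [|j IH] [|i] // _ ijn.
    by apply: XA; move: ijn; rewrite addn0.
  apply: right_perp_plus => [X1 X2 XX1 XX2 e|].
    by apply: rig => //; apply: leq_trans ijn; rewrite leq_addr.
  by apply: IH; rewrite // addSnnS.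
(* Downward induction: j counts the steps back from the n-th iterate. *)
suff Xj j : (j <= n)%N -> X (iter (n - j) (fun A => lt_plus (T A)) A).
  by have := Xj n (leqnn n); rewrite subnn.
elim: j => [|j IH] jn; first by rewrite subn0.
have := IH (ltnW jn); rewrite -(subnSK jn) /=.
set B := iter _ _ _ => XB'; have [XXB _] := lt_approx (T B).
apply: (split_mem (lt_real (T B))) XXB.
apply: (perp (n - j.+1)%N 1%N) => //.
by rewrite add1n subnSK // leq_subr.
Qed.

End Approximations.

(** * Dual statements *)

Section OppositeApproximations.
Context {R : comPzRingType} {C : extriCat R}.

Definition opp_subcat (X : subcat C) : subcat (opp_extri C).
Proof.
refine (@Subcat R (opp_extri C) (smem X) _ (sub_zero X) (@sub_dsum _ _ X)
  (@sub_summand _ _ X)) => A B [f [g [gf fg]]].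
by apply: sub_iso; exists g, f.
Defined.

Variable X : subcat C.

Definition opp_left_tri (A : C) (T : left_tri X A) : right_tri (opp_subcat X) A.
Proof.
refine (@RightTri R (opp_extri C) (opp_subcat X) A (lt_mid T) (lt_plus T)
  (lt_y T) (lt_x T) (lt_e T) (lt_real T) _); exact: lt_approx T.
Defined.

Definition opp_right_tri (A : C) (T : right_tri X A) : left_tri (opp_subcat X) A.
Proof.
refine (@LeftTri R (opp_extri C) (opp_subcat X) A (rt_mid T) (rt_minus T)
  (rt_y T) (rt_x T) (rt_e T) (rt_real T) _); exact: rt_approx T.
Defined.

Lemma opp_Ext_vanish i (A B : C) :
  (forall e : @Ext R (opp_extri C) i.+1 A B, e = 0) <->
  (forall e : @Ext R C i.+1 B A, e = 0).
Proof.
have iso := opp_bimod_pow (ext C) i; split=> H.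
  exact: (bimod_iso_vanish iso H).
exact: (bimod_iso_vanish (bimod_iso_sym iso) H).
Qed.

Lemma opp_rigid n : rigid X n -> rigid (opp_subcat X) n.
Proof.
by move=> rig [|i] // ik X1 X2 XX1 XX2; apply/opp_Ext_vanish/rig.
Qed.

Lemma opp_right_perp i :
  @right_perp R (opp_extri C) (opp_subcat X) i.+1 = left_perp X i.+1.
Proof. by apply/seteqP; split=> A pA Y XY; apply/opp_Ext_vanish/pA. Qed.

Lemma opp_bigcap_right_perp n :
  (\bigcap_(i in [set i | (1 <= i <= n)%N])
     @right_perp R (opp_extri C) (opp_subcat X) i)%classic
  = (\bigcap_(i in [set i | (1 <= i <= n)%N]) left_perp X i)%classic.
Proof.
by apply: eq_bigcapr => -[|i] // _; rewrite opp_right_perp.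
Qed.

Lemma retract_mem_op (A : C) : right_tri X A -> factors X (idc A) -> X A.
Proof.
move=> T [M XM [g [h hg]]].
by apply: (retract_mem (opp_right_tri T)); exists M => //; exists h, g.
Qed.

Lemma iter_plus_mem n (T : forall A : C, left_tri X A) :
  rigid X n ->
  smem X = (\bigcap_(i in [set i | (1 <= i <= n)%N]) left_perp X i)%classic ->
  forall A, X (iter n (fun A => lt_plus (T A)) A).
Proof.
move=> /opp_rigid rig; rewrite -opp_bigcap_right_perp => XE A.
exact: (@iter_minus_mem R (opp_extri C) (opp_subcat X) n
  (fun A => opp_left_tri (T A)) rig XE A).
Qed.

Lemma left_perp_mem n (T : forall A : C, right_tri X A) :
  rigid X n -> (forall A, X (iter n (fun A => rt_minus (T A)) A)) ->
  smem X = (\bigcap_(i in [set i | (1 <= i <= n)%N]) left_perp X i)%classic.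
Proof.
move=> /opp_rigid rig Xn; rewrite -opp_bigcap_right_perp.
exact: (@right_perp_mem R (opp_extri C) (opp_subcat X) n
  (fun A => opp_right_tri (T A)) rig Xn).
Qed.

End OppositeApproximations.

(** * Vanishing of powers of the suspension and the loop *)

Section ZeroPowers.
Context {R : comPzRingType}.

Lemma functor_powE (C : addCat R) (F : functor C C) n (A : C) :
  functor_pow F n A = iter n (fobj F) A.
Proof. by elim: n => //= n ->. Qed.

Lemma iso_zero_functorP (C D : addCat R) (F : functor C D) :
  F \cong zero_functor C D <-> forall A, idc (F A) = 0.
Proof.
split=> [[eta [_ iso]] A | F0].
  have [g [<- _]] := iso A.
  by rewrite [eta A]zobj_term comp0r.
exists (fun A => 0); split=> [A B f|A]; first by rewrite !comp0l.
exists 0; split; first by rewrite comp0r F0.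
by rewrite comp0r (zobj_init (idc _)).
Qed.

Lemma quot_idc_eq0 (C : addCat R) (X : subcat C) (A : C) :
  idc (A : quot_cat X) = 0 <-> factors X (idc A).
Proof.
have -> : (0 : qhom X A A) = qpi X 0 by [].
by split=> [/qpiP | fA]; [rewrite subr0 | apply/qpiP; rewrite subr0].
Qed.

(** The hypothesis on X is the retract property that approximation triangles
    provide. *)
Lemma pow_iso_zero (C : addCat R) (X : subcat C)
    (F : functor (quot_cat X) (quot_cat X)) n :
  (forall A : C, factors X (idc A) -> X A) ->
  functor_pow F n \cong zero_functor (quot_cat X) (quot_cat X) <->
  forall A, X (iter n (fobj F) A).
Proof.
move=> retr; apply: (iff_trans (iso_zero_functorP _)).
split=> H A; have := H A; rewrite functor_powE.
  by move=> /quot_idc_eq0/retr.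
move=> XA; apply/quot_idc_eq0.
by exists (iter n (fobj F) A) => //; exists (idc _), (idc _); rewrite comp1l.
Qed.
End ZeroPowers.

Lemma suspension_pow_zeroP (R : comPzRingType) (C : extriCat R) (X : subcat C)
    (T : forall A : C, left_tri X A) n :
  functor_pow (suspension T) n \cong zero_functor (quot_cat X) (quot_cat X) <->
  forall A, X (iter n (fun A => lt_plus (T A)) A).
Proof. by apply: pow_iso_zero => A; apply: retract_mem. Qed.

Lemma loop_pow_zeroP (R : comPzRingType) (C : extriCat R) (X : subcat C)
    (T : forall A : C, right_tri X A) n :
  functor_pow (loop T) n \cong zero_functor (quot_cat X) (quot_cat X) <->
  forall A, X (iter n (fun A => rt_minus (T A)) A).
Proof. by apply: pow_iso_zero => A; apply: retract_mem_op. Qed.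

Local Open Scope classical_set_scope.

Theorem theorem3p7 (R : comPzRingType) (n : nat) (C : extriCat R)
    (X : subcat C) :
  (1 <= n)%N ->
  (strongly_cov_finite X -> rigid X n ->
     forall T : (forall A : C, left_tri X A),
     (smem X = \bigcap_(i in [set i | (1 <= i <= n)%N]) left_perp X i ->
        functor_pow (suspension T) n \cong zero_functor (quot_cat X) (quot_cat X))
     /\
     (functor_pow (suspension T) n \cong zero_functor (quot_cat X) (quot_cat X) ->
        smem X = \bigcap_(i in [set i | (1 <= i <= n)%N]) right_perp X i))
  /\
  (strongly_contrav_finite X -> rigid X n ->
     forall T : (forall A : C, right_tri X A),
     (smem X = \bigcap_(i in [set i | (1 <= i <= n)%N]) right_perp X i ->
        functor_pow (loop T) n \cong zero_functor (quot_cat X) (quot_cat X))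
     /\
     (functor_pow (loop T) n \cong zero_functor (quot_cat X) (quot_cat X) ->
        smem X = \bigcap_(i in [set i | (1 <= i <= n)%N]) left_perp X i)).
Proof.
move=> _; split=> _ rig T; split.
- by move=> XE; apply/suspension_pow_zeroP; apply: iter_plus_mem.
- by move=> /suspension_pow_zeroP; apply: right_perp_mem.
- by move=> XE; apply/loop_pow_zeroP; apply: iter_minus_mem.
- by move=> /loop_pow_zeroP; apply: left_perp_mem.
Qed.
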